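(* There are absolute constants (hidden in the $O(\cdot)$ and $\Omega(\cdot)$ below) such that the following holds. Let $\mathbf{A}\in\mathbb{R}^{n\times n}$ be positive semidefinite, $\mathbf{x}\in\mathbb{R}^n$, and $0<\epsilon<1$. Let $k=O(\log(1/\epsilon))$, $B=\log\left(\frac{n\max(\|\mathbf{A}\|,1)}{\epsilon}\right)$, and $\epsilon_1=2^{-\Omega(B)}$. Let $\mathcal{A}(\mathbf{A},\mathbf{w},k,\epsilon_1)$ be an algorithm returning, for any $\mathbf{w}\in\mathbb{R}^n$, a vector $\mathbf{z}$ with $$\left\|\left(\mathbf{I}+\tfrac{1}{k}\mathbf{A}\right)^{-1}\mathbf{w}-\mathbf{z}\right\|\le\epsilon_1\|\mathbf{w}\|.$$ There is an algorithm running on a computer with $\Omega(B)$ bits of precision that makes $k$ calls to $\mathcal{A}(\mathbf{A},\mathbf{w},k,\epsilon_1)$ and uses $O(nk+kB^2)$ additional time to return $\mathbf{y}$ satisfying $$\|\exp(-\mathbf{A})\mathbf{x}-\mathbf{y}\|\le\epsilon\|\mathbf{x}\|.$$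
   Context: $\|\cdot\|$ is the Euclidean norm for vectors and the spectral norm for matrices. Floating-point model: a computer with $b$ bits of precision has relative precision $\epsilon_{mach}=2^{-b}$, meaning that for $\circ\in\{+,-,\times,\div\}$ the computed value is $\mathrm{fl}(x\circ y)=(1+\delta)(x\circ y)$ and $\mathrm{fl}(\sqrt{x})=(1+\delta)\sqrt{x}$ with $|\delta|\le\epsilon_{mach}$. Overflow and underflow are ignored. Runtimes are in the unit-cost RAM model (each such operation costs $O(1)$), and evaluating the required scalar functions (such as $e^{-k/x+k}$) to relative error $\epsilon_{mach}$ costs $O(1)$. Asymptotic notation: $k$, $\log(1/\epsilon_1)$ and the number of bits are taken to be suitable (sufficiently large) absolute constants times the indicated expressions, where each expression inside $O(\cdot)$ or $\Omega(\cdot)$ is read as at least $1$. *)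

(* Defs.v *)
From HB Require Import structures.
From mathcomp Require Import all_boot all_order all_algebra.
From mathcomp Require Import all_classical all_reals all_analysis.
Set Implicit Arguments.
Unset Strict Implicit.
Unset Printing Implicit Defensive.
Import Order.TTheory GRing.Theory Num.Theory.
Import numFieldNormedType.Exports.
Local Open Scope ring_scope.
Local Open Scope classical_set_scope.

Definition enorm (R : realType) (n : nat) (v : 'cV[R]_n) : R :=
  Num.sqrt (\sum_i v i 0 ^+ 2).

(* The spectral norm, as the operator norm induced by [enorm]. *)
Definition mxnorm (R : realType) (n : nat) (A : 'M[R]_n) : R :=
  sup [set enorm (A *m v) | v in [set v : 'cV[R]_n | enorm v <= 1]].

Definition psd (R : realType) (n : nat) (A : 'M[R]_n) : Prop :=
  A^T = A /\ forall v : 'cV[R]_n, 0 <= (v^T *m A *m v) 0 0.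

Definition expmx (R : realType) (n : nat) (A : 'M[R]_n) : 'M[R]_n :=
  limn (series (fun m : nat => (m`!%:R : R)^-1 *: A ^+ m)).

(* A unit-cost RAM with natural-number registers and heap (addition, truncated
   subtraction and order only) and floating-point registers and heap.  Programs
   are finite syntax: they do not depend on the problem instance and contain no
   real constants.  The arguments of all instructions except the constant of
   [IConst] are register numbers, the destination coming first. *)
Inductive arith := Add | Sub | Mul | Div.

Inductive instr :=
| IConst of nat & nat
| IAdd of nat & nat & nat
| ISub of nat & nat & nat
| ILoad of nat & nat            (* d, address register *)
| IStore of nat & nat           (* address register, source *)
| FMove of nat & nat
| FLoad of nat & nat            (* d, (integer) address register *)
| FStore of nat & nat           (* (integer) address register, source *)
| FOfNat of nat & nat           (* conversion of an integer register *)
| FArith of arith & nat & nat & nat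
| FSqrt of nat & nat
| FExp of nat & nat & nat       (* d, integer register k, x: exp(-k/x + k) *)
| Call of nat & nat.            (* address registers of the result and of w *)

Inductive test :=
| ILt of nat & nat
| FLt of nat & nat.

Inductive prog :=
| Skip
| Instr of instr
| Seq of prog & prog
| If of test & prog & prog
| While of test & prog.

(* [time] counts the executed instructions and tests other than calls. *)
Record state (R : realType) := State {
  ireg : nat -> nat;
  iheap : nat -> nat;
  freg : nat -> R;
  fheap : nat -> R;
  time : nat;
  ncalls : nat }.

Definition upd (T : Type) (f : nat -> T) (a : nat) (v : T) : nat -> T :=
  fun j => if j == a then v else f j.

Definition read_vec (R : realType) (n : nat) (f : nat -> R) (a : nat) :
    'cV[R]_n :=
  \col_(i < n) f (a + i)%N.

Definition write_vec (R : realType) (n : nat) (f : nat -> R) (a : nat)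
    (z : 'cV[R]_n) : nat -> R :=
  fun j => if (a <= j)%N then oapp (fun i => z i 0) (f j) (insub (j - a)%N)
           else f j.

Definition tick (R : realType) (s : state R) : state R :=
  State (ireg s) (iheap s) (freg s) (fheap s) (time s).+1 (ncalls s).

Definition set_ireg (R : realType) (s : state R) (d v : nat) : state R :=
  State (upd (ireg s) d v) (iheap s) (freg s) (fheap s) (time s) (ncalls s).

Definition set_freg (R : realType) (s : state R) (d : nat) (v : R) : state R :=
  State (ireg s) (iheap s) (upd (freg s) d v) (fheap s) (time s) (ncalls s).

(* [delta t] is the relative rounding error committed at time [t].  Quantifying
   over all sequences [delta] (and [solver] below) covers every, even adaptive,
   choice of the errors, while the semantics itself stays deterministic. *)
Definition rnd (R : realType) (delta : nat -> R) (s : state R) (v : R) : R :=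
  (1 + delta (time s)) * v.

Definition arith_op (R : realType) (o : arith) (x y : R) : option R :=
  match o with
  | Add => Some (x + y)
  | Sub => Some (x - y)
  | Mul => Some (x * y)
  | Div => if y == 0 then None else Some (x / y)
  end.

(* [solver j w] is the vector returned by the [j]-th call on argument [w].
   [None] is a fault (division by zero, square root of a negative number),
   on which the machine gets stuck. *)
Definition exec_instr (R : realType) (n : nat)
    (solver : nat -> 'cV[R]_n -> 'cV[R]_n) (delta : nat -> R)
    (c : instr) (s : state R) : option (state R) :=
  match c with
  | IConst d v => Some (tick (set_ireg s d v))
  | IAdd d a b => Some (tick (set_ireg s d (ireg s a + ireg s b)%N))
  | ISub d a b => Some (tick (set_ireg s d (ireg s a - ireg s b)%N))
  | ILoad d a => Some (tick (set_ireg s d (iheap s (ireg s a))))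
  | IStore a v =>
      Some (State (ireg s) (upd (iheap s) (ireg s a) (ireg s v))
                  (freg s) (fheap s) (time s).+1 (ncalls s))
  | FMove d a => Some (tick (set_freg s d (freg s a)))
  | FLoad d a => Some (tick (set_freg s d (fheap s (ireg s a))))
  | FStore a v =>
      Some (State (ireg s) (iheap s) (freg s)
                  (upd (fheap s) (ireg s a) (freg s v))
                  (time s).+1 (ncalls s))
  | FOfNat d a => Some (tick (set_freg s d (rnd delta s (ireg s a)%:R)))
  | FArith o d a b =>
      if arith_op o (freg s a) (freg s b) is Some v
      then Some (tick (set_freg s d (rnd delta s v))) else None
  | FSqrt d a =>
      if 0 <= freg s a
      then Some (tick (set_freg s d (rnd delta s (Num.sqrt (freg s a)))))
      else None
  | FExp d a b =>
      let k : R := (ireg s a)%:R in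
      let x := freg s b in
      if x == 0 then None
      else Some (tick (set_freg s d (rnd delta s (expR (- (k / x) + k)))))
  | Call d a =>
      let z := solver (ncalls s) (read_vec n (fheap s) (ireg s a)) in
      Some (State (ireg s) (iheap s) (freg s)
                  (write_vec (fheap s) (ireg s d) z)
                  (time s) (ncalls s).+1)
  end.

Definition eval_test (R : realType) (t : test) (s : state R) : bool :=
  match t with
  | ILt a b => (ireg s a < ireg s b)%N
  | FLt a b => freg s a < freg s b
  end.

Inductive exec (R : realType) (n : nat)
    (solver : nat -> 'cV[R]_n -> 'cV[R]_n) (delta : nat -> R) :
    prog -> state R -> state R -> Prop :=
| ExecSkip s : exec solver delta Skip s s
| ExecInstr c s s' :
    exec_instr solver delta c s = Some s' -> exec solver delta (Instr c) s s'
| ExecSeq p q s s1 s' :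
    exec solver delta p s s1 -> exec solver delta q s1 s' ->
    exec solver delta (Seq p q) s s'
| ExecIf t p q s s' :
    exec solver delta (if eval_test t s then p else q) (tick s) s' ->
    exec solver delta (If t p q) s s'
| ExecWhileDone t p s :
    ~~ eval_test t s -> exec solver delta (While t p) s (tick s)
| ExecWhileStep t p s s1 s' :
    eval_test t s -> exec solver delta p (tick s) s1 ->
    exec solver delta (While t p) s1 s' ->
    exec solver delta (While t p) s s'.

(* Hence the existence of a final state expresses that the (unique) run
   terminates without a fault. *)
Lemma exec_det (R : realType) (n : nat)
    (solver : nat -> 'cV[R]_n -> 'cV[R]_n) (delta : nat -> R)
    (p : prog) (s s1 s2 : state R) :
  exec solver delta p s s1 -> exec solver delta p s s2 -> s1 = s2.
Proof.
move=> e1; elim: e1 s2 => {p s s1}.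
- by move=> s s2 e2; inversion e2.
- by move=> c s s' e s2 e2; inversion e2; congruence.
- move=> p q s s1 s' _ IH1 _ IH2 s2 e2; inversion e2 as [| |? ? ? s3 ? e3| | |].
  by apply: IH2; rewrite (IH1 s3).
- by move=> t p q s s' _ IH s2 e2; inversion e2; subst; apply: IH.
- by move=> t p s /negPf tF s2 e2; inversion e2; congruence.
- move=> t p s s1 s' tT _ IH1 _ IH2 s2 e2.
  inversion e2 as [| | | |? ? ? tF|? ? ? s3 ? ? e3]; subst; first by rewrite tT in tF.
  by apply: IH2; rewrite (IH1 s3).
Qed.

(* Inputs: [n] and [k] in the integer registers 0 and 1, [eps] and [eps1] in the
   floating-point registers 0 and 1, and [x] in the cells 0, ..., n-1 of the
   floating-point heap, where the output is expected as well.  The matrix is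
   accessible only through [Call]. *)
Definition init (R : realType) (n k : nat) (eps eps1 : R) (x : 'cV[R]_n) :
    state R :=
  State (upd (upd (fun=> 0%N) 0 n) 1 k) (fun=> 0%N)
        (upd (upd (fun=> 0) 0 eps) 1 eps1) (write_vec (fun=> 0) 0 x) 0 0.

Definition output (R : realType) (n : nat) (s : state R) : 'cV[R]_n :=
  read_vec n (fheap s) 0.

Definition Bparam (R : realType) (n : nat) (A : 'M[R]_n) (eps : R) : R :=
  ln (n%:R * Num.max (mxnorm A) 1 / eps).

(* Main.v *)
Require Import Defs.
From HB Require Import structures.
From mathcomp Require Import all_boot all_order all_algebra.
From mathcomp Require Import complex.
From mathcomp Require Import all_classical all_reals all_analysis.
From mathcomp Require Import ring lra zify.
Set Implicit Arguments.
Unset Strict Implicit.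
Unset Printing Implicit Defensive.
Import Order.TTheory GRing.Theory Num.Theory.
Import numFieldNormedType.Exports.
Local Open Scope ring_scope.

(* The program evaluates a polynomial of degree k - 1 in S = (I + A/k)^-1.  With
   t = 1 / (1 + lambda / k) and z = 1 - t one has exp (- lambda) =
   exp (- k z / (1 - z)), and exp (- k z / (1 - z)) (1 - z)^-N has Taylor
   coefficients c_j (Laguerre polynomials) given by a three-term recurrence.
   The polynomial is t^N sum_(j < M) c_j (1 - t)^j with k = N + M and N about
   3 M.  Dividing it by exp (- k z / (1 - z)) gives a function of z whose
   derivative, by the recurrence, retains only the two terms of degrees M - 1
   and M; since z (1 - z)^3 <= 27 / 256 and |c_j| <= (8 M / 3)^j / j!, the
   approximation error is O(M (8 / 9)^M), uniformly on 0 < t <= 1.  All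
   intermediate quantities are at most exponential in k, so rounding and solver
   errors are amplified by exp (O(k)) only, which O(log (1/eps)) additional bits
   absorb; no cancellation estimate is needed. *)

(** * Spectral theorem and functional calculus *)

(** Large eigenvalues lambda correspond to z near 1, where the powers z^j no longer decay while the
    available bounds on c_j are exponential in M; truncating a series in z alone would give nothing
    there. The prefactor t^N is what repairs this: the two terms surviving in the derivative carry
    (1 - z)^(N - 2) next to z^(M - 1), and with N near 3 M this product is at most (27/256)^(M - 1)
    on the whole interval. Since lambda enters only through t, the norm of the matrix never appears
    in the degree. The second constraint is that programs contain no real constants, so the c_j must
    themselves be computed in floating point. Their rounding errors obey a recurrence of the same
    shape with larger coefficients, so that one majorant argument, [bnd_step], serves twice: with
    ratio 8/3 for the exact coefficients and with ratio 6 for the errors. All errors of the vector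
    part are then tracked against crude geometric bounds (factor 4 per step of the first loop, 2 per
    step of the second). *)

Lemma symmetric_eigenvalue (R : realType) (n : nat) (A : 'M[R]_n) :
  (0 < n)%N -> A^T = A -> exists a, eigenvalue A a.
Proof.
(* Over the complex numbers the matrix is hermitian, hence unitarily diagonalizable with real
   diagonal; [eigenvalue_map] then brings the eigenvalue back to the real field. *)
move=> n0 symA; pose toC := @real_complex R.
pose B := map_mx toC A.
have hB : B \is hermsymmx.
  apply: realsym_hermsym.
    apply/is_hermitianmxP; rewrite expr0 scale1r map_mx_id //.
    by rewrite /B map_trmx symA.
  by apply/mxOverP => i j; rewrite mxE complex_real.
have /orthomx_spectralP eqB := hermitian_normalmx hB.
have /mxOverP dR := hermitian_spectral_diag_real hB.
have /complex_realP[a da] := dR 0 (Ordinal n0).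
exists a; rewrite -(@eigenvalue_map _ _ toC) -/B /toC /= -da.
set D := spectral_diag B in eqB da *; set P := spectralmx B in eqB *.
have Pu : P \in unitmx by exact: spectral_unit.
apply/eigenvalueP; exists (row (Ordinal n0) P).
  rewrite [X in _ *m X]eqB !rowE !mulmxA (mulmxK Pu).
  by rewrite -(rowE _ (diag_mx D)) row_diag_mx -scalemxAl.
apply/eqP => /(congr1 (mulmx^~ (invmx P))).
rewrite rowE mulmxK // mul0mx => /rowP/(_ (Ordinal n0)).
by rewrite !mxE !eqxx => /eqP; rewrite oner_eq0.
Qed.

Lemma sum_sqr_gt0 (R : realDomainType) (I : finType) (F : I -> R) (i : I) :
  F i != 0 -> 0 < \sum_j F j ^+ 2.
Proof.
move=> Fi0; rewrite (bigD1 i) //= ltr_pwDl ?exprn_even_gt0 //.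
by apply: sumr_ge0 => j _; exact: sqr_ge0.
Qed.

Lemma conjugate_diagonal (R : realType) (n : nat) (A B H W : 'M[R]_n) d :
  H^T = H -> H *m H = 1%:M -> A = H *m B *m H ->
  W^T *m W = 1%:M -> B = W^T *m diag_mx d *m W ->
  exists (V : 'M[R]_n) (d : 'rV[R]_n),
    V^T *m V = 1%:M /\ A = V^T *m diag_mx d *m V.
Proof.
move=> symH HH -> WW ->; exists (W *m H), d; rewrite trmx_mul symH; split.
  by rewrite mulmxA -(mulmxA H) WW mulmx1 HH.
by rewrite !mulmxA.
Qed.

(** Induction on the dimension: a reflection moves a unit eigenvector to the first basis vector,
    after which symmetry splits off a block of size 1. *)
Lemma spectral_real (R : realType) (n : nat) (A : 'M[R]_n) :
  A^T = A -> exists (V : 'M[R]_n) (d : 'rV[R]_n),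
    V^T *m V = 1%:M /\ A = V^T *m diag_mx d *m V.
Proof.
elim: n A => [|n IH] A symA.
  exists 1%:M, 0; split; first by rewrite [LHS]thinmx0 [RHS]thinmx0.
  by rewrite [LHS]thinmx0 [RHS]thinmx0.
have [a /eigenvalueP[u uA u0]] := symmetric_eigenvalue (ltn0Sn n) symA.
have [v vA vv] : exists2 v : 'cV[R]_n.+1, A *m v = a *: v & v^T *m v = 1%:M.
  pose s := (u *m u^T) 0 0.
  have s0 : 0 < s.
    rewrite /s mxE; under eq_bigr do rewrite mxE -expr2.
    by have /rV0Pn[i ui] := u0; exact: (@sum_sqr_gt0 _ _ (fun j => u 0 j) i ui).
  exists ((Num.sqrt s)^-1 *: u^T).
    by rewrite -scalemxAr -{1}symA -trmx_mul uA linearZ /= !scalerA mulrC.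
  rewrite -scalemxAr [X in X *m _]linearZ /= trmxK -scalemxAl scalerA.
  rewrite [u *m u^T]mx11_scalar -/s -invfM -expr2 sqr_sqrtr ?(ltW s0) //.
  by rewrite scale_scalar_mx mulVf // gt_eqF.
pose e0 : 'cV[R]_(1 + n) := col_mx 1%:M 0.
have ee : e0^T *m e0 = 1%:M.
  by rewrite /e0 tr_col_mx mul_row_col trmx1 mul1mx trmx0 mul0mx addr0.
(* Householder reflection along w = v - e0, which exchanges the unit vectors [e0] and [v]; the
   identity takes its place when w = 0. *)
have [H [symH HH He]] : exists H : 'M[R]_n.+1, [/\ H^T = H, H *m H = 1%:M & H *m e0 = v].
  pose w := v - e0.
  have [w0|w0] := eqVneq w 0.
    exists 1%:M; rewrite trmx1 !mul1mx; split=> //.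
    by apply/esym/eqP; rewrite -subr_eq0 -/w w0.
  pose s := (w^T *m w) 0 0.
  have wwE : w^T *m w = s%:M by rewrite [LHS]mx11_scalar.
  have s0 : s != 0.
    rewrite gt_eqF // /s mxE; under eq_bigr do rewrite mxE -expr2.
    by have /cV0Pn[i wi] := w0; exact: (@sum_sqr_gt0 _ _ (fun j => w j 0) i wi).
  pose c := (v^T *m e0) 0 0.
  have veE : v^T *m e0 = c%:M by rewrite [LHS]mx11_scalar.
  have evE : e0^T *m v = c%:M by rewrite -[LHS]trmxK trmx_mul trmxK veE tr_scalar_mx.
  have wT : w^T = v^T - e0^T by rewrite /w linearB.
  (* Both vectors being units, this makes 2 (c - 1) / s equal to -1, which is what sends [e0] to
     [v]. *)
  have sE : s = 2 - 2 * c.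
    rewrite /s wT /w mulmxBl !mulmxBr vv ee veE evE !mxE /= ?mulr1n.
    lra.
  exists (1%:M - (2 / s) *: (w *m w^T)); split.
  - by rewrite linearB linearZ /= trmx1 trmx_mul trmxK.
  - rewrite mulmxBl mul1mx mulmxBr mulmx1 -scalemxAl -scalemxAr.
    have -> : w *m w^T *m (w *m w^T) = s *: (w *m w^T).
      by rewrite mulmxA -(mulmxA w) wwE mul_mx_scalar -scalemxAl.
    rewrite !scalerA (_ : 2 / s * (2 / s) * s = 2 / s + 2 / s); last by field.
    by rewrite scalerDl opprB addrK subrK.
  - have we : w^T *m e0 = (c - 1)%:M by rewrite wT mulmxBl veE ee -raddfB.
    rewrite mulmxBl mul1mx -scalemxAl -mulmxA we mul_mx_scalar scalerA.
    rewrite (_ : 2 / s * (c - 1) = -1); last by rewrite sE in s0 *; field.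
    by rewrite scaleN1r opprK addrC subrK.
pose B : 'M[R]_(1 + n) := H *m A *m H.
have symB : B^T = B by rewrite /B !trmx_mul symH symA mulmxA.
have Be : B *m e0 = a *: e0.
  by rewrite /B -!mulmxA He vA -scalemxAr -He mulmxA HH mul1mx.
have BE : B = block_mx a%:M 0 0 (drsubmx B).
  have h : ulsubmx B = a%:M /\ dlsubmx B = 0.
    move: Be; rewrite -{1}[B]submxK /e0 mul_block_col !mulmx1 !mulmx0 !addr0.
    by rewrite scale_col_mx scaler0 scalemx1 => /eq_col_mx.
  have h2 : ursubmx B = 0.
    by rewrite -[B]trmxK -trmx_dlsub symB h.2 trmx0.
  by rewrite -{1}[B]submxK h.1 h.2 h2.
have symD : (drsubmx B)^T = drsubmx B by rewrite trmx_drsub symB.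
have [V [d [VV dE]]] := IH _ symD.
have AE : A = H *m B *m H by rewrite /B !mulmxA HH mul1mx -mulmxA HH mulmx1.
pose W : 'M[R]_(1 + n) := block_mx 1%:M 0 0 V.
pose dd : 'rV[R]_(1 + n) := row_mx a%:M d.
have WT : W^T = block_mx 1%:M 0 0 V^T by rewrite tr_block_mx !trmx0 trmx1.
have WW : W^T *m W = 1%:M.
  rewrite WT mulmx_block !mulmx0 !mul0mx !addr0 !add0r mulmx1 VV.
  by rewrite -scalar_mx_block.
have BW : B = W^T *m diag_mx dd *m W.
  have -> : diag_mx dd = block_mx a%:M 0 0 (diag_mx d).
    rewrite diag_mx_row; congr block_mx; apply/matrixP => i j.
    by rewrite !ord1 !mxE.
  by rewrite {1}BE dE WT !mulmx_block !(mulmx0, mul0mx, addr0, add0r, mulmx1, mul1mx).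
exact: (conjugate_diagonal symH HH AE WW BW).
Qed.

(** * Euclidean norm *)

Lemma enorm_ge0 (R : realType) n (v : 'cV[R]_n) : 0 <= enorm v.
Proof. exact: sqrtr_ge0. Qed.

Lemma sqr_enorm (R : realType) n (v : 'cV[R]_n) :
  enorm v ^+ 2 = \sum_i v i 0 ^+ 2.
Proof. by rewrite sqr_sqrtr ?sumr_ge0 // => i _; exact: sqr_ge0. Qed.

Lemma enormZ (R : realType) n (a : R) (v : 'cV[R]_n) :
  enorm (a *: v) = `|a| * enorm v.
Proof.
rewrite /enorm; under eq_bigr do rewrite mxE exprMn.
by rewrite -mulr_sumr sqrtrM ?sqr_ge0 // sqrtr_sqr.
Qed.

Lemma enormN (R : realType) n (v : 'cV[R]_n) : enorm (- v) = enorm v.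
Proof. by rewrite -scaleN1r enormZ normrN1 mul1r. Qed.

Lemma enorm_mono (R : realType) n (c : R) (v w : 'cV[R]_n) : 0 <= c ->
  (forall i, `|v i 0| <= c * `|w i 0|) -> enorm v <= c * enorm w.
Proof.
move=> c0 vw; rewrite -[c in c * _]ger0_norm // -enormZ ler_wsqrtr //.
apply: ler_sum => i _; rewrite -[leLHS]real_normK ?num_real //.
rewrite -[leRHS]real_normK ?num_real // lerXn2r ?nnegrE //.
by rewrite mxE normrM (ger0_norm c0).
Qed.

Lemma cauchy_schwarz (R : realType) n (v w : 'cV[R]_n) :
  \sum_i v i 0 * w i 0 <= enorm v * enorm w.
Proof.
have [v0|v0] := eqVneq (enorm v) 0.
  rewrite v0 mul0r big1 // => i _.
  have /eqP := sqr_enorm v; rewrite v0 expr0n eq_sym psumr_eq0 /=; last first.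
    by move=> j _; exact: sqr_ge0.
  by move=> /allP/(_ i (mem_index_enum i)); rewrite /= sqrf_eq0 => /eqP ->; rewrite mul0r.
have [w0|w0] := eqVneq (enorm w) 0.
  rewrite w0 mulr0 big1 // => i _.
  have /eqP := sqr_enorm w; rewrite w0 expr0n eq_sym psumr_eq0 /=; last first.
    by move=> j _; exact: sqr_ge0.
  by move=> /allP/(_ i (mem_index_enum i)); rewrite /= sqrf_eq0 => /eqP ->; rewrite mulr0.
have vp : 0 < enorm v by rewrite lt_def v0 enorm_ge0.
have wp : 0 < enorm w by rewrite lt_def w0 enorm_ge0.
(* The squared norm of |w| v - |v| w equals 2 |v| |w| (|v| |w| - <v, w>), and the degenerate cases
   are already excluded. *)
have : 0 <= \sum_i (enorm w * v i 0 - enorm v * w i 0) ^+ 2.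
  by apply: sumr_ge0 => i _; exact: sqr_ge0.
have -> : \sum_i (enorm w * v i 0 - enorm v * w i 0) ^+ 2 =
  enorm w ^+ 2 * (\sum_i v i 0 ^+ 2) + enorm v ^+ 2 * (\sum_i w i 0 ^+ 2)
  - 2 * enorm v * enorm w * \sum_i v i 0 * w i 0.
  rewrite !mulr_sumr -big_split -sumrB /=; apply: eq_bigr => i _; ring.
rewrite -!sqr_enorm.
have -> : enorm w ^+ 2 * enorm v ^+ 2 + enorm v ^+ 2 * enorm w ^+ 2
  - 2 * enorm v * enorm w * \sum_i v i 0 * w i 0 =
  2 * enorm v * enorm w * (enorm v * enorm w - \sum_i v i 0 * w i 0) by ring.
by rewrite pmulr_rge0 ?subr_ge0 // !mulr_gt0.
Qed.

Lemma enormD (R : realType) n (v w : 'cV[R]_n) :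
  enorm (v + w) <= enorm v + enorm w.
Proof.
rewrite -(@ler_pXn2r _ 2) ?nnegrE ?addr_ge0 ?enorm_ge0 //.
rewrite sqr_enorm; under eq_bigr do rewrite mxE sqrrD.
rewrite !big_split /= -!sqr_enorm sqrrD; have := cauchy_schwarz v w.
lra.
Qed.

Lemma enormB (R : realType) n (v w : 'cV[R]_n) :
  enorm (v - w) <= enorm v + enorm w.
Proof. by rewrite (le_trans (enormD _ _)) // enormN. Qed.

Lemma enorm_orthogonal (R : realType) n (V : 'M[R]_n) (v : 'cV[R]_n) :
  V^T *m V = 1%:M -> enorm (V *m v) = enorm v.
Proof.
move=> VV; have E (w : 'cV[R]_n) : \sum_i w i 0 ^+ 2 = (w^T *m w) 0 0.
  by rewrite mxE; apply: eq_bigr => i _; rewrite mxE expr2.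
by rewrite /enorm !E trmx_mul mulmxA -(mulmxA _ V^T) VV mulmx1.
Qed.

(* Functional calculus in the orthonormal eigenbasis given by the rows of [V]. *)
Definition spec (R : realType) n (V : 'M[R]_n) (g : 'I_n -> R) : 'M[R]_n :=
  V^T *m diag_mx (\row_i g i) *m V.

Section Spec.
Variables (R : realType) (n : nat) (V : 'M[R]_n).
Hypothesis VV : V^T *m V = 1%:M.

Lemma specD g h : spec V (fun i => g i + h i) = spec V g + spec V h.
Proof.
rewrite /spec -mulmxDl -mulmxDr -linearD; congr (_ *m diag_mx _ *m _).
by apply/rowP => i; rewrite !mxE.
Qed.

Lemma specZ a g : spec V (fun i => a * g i) = a *: spec V g.
Proof.
rewrite /spec scalemxAl scalemxAr -linearZ; congr (_ *m diag_mx _ *m _).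
by apply/rowP => i; rewrite !mxE.
Qed.

Lemma spec1 : spec V (fun=> 1) = 1%:M.
Proof.
rewrite /spec (_ : diag_mx _ = 1%:M) ?mulmx1 //.
by rewrite -diag_const_mx; congr diag_mx; apply/rowP => i; rewrite !mxE.
Qed.

Lemma specB g h : spec V (fun i => g i - h i) = spec V g - spec V h.
Proof.
rewrite -scaleN1r -specZ -specD; congr spec.
by apply/funext => i; rewrite mulN1r.
Qed.

Lemma specM g h : spec V (fun i => g i * h i) = spec V g *m spec V h.
Proof.
have VV' : V *m V^T = 1%:M by exact: mulmx1C.
rewrite /spec.
have -> : diag_mx (\row_i (g i * h i)) =
    diag_mx (\row_i g i) *m diag_mx (\row_i h i).
  rewrite mulmx_diag; congr diag_mx.
  by apply/rowP => i; rewrite !mxE.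
by rewrite -!mulmxA (mulmxA V) VV' mul1mx.
Qed.

Lemma spec_sum (I : Type) (r : seq I) (g : I -> 'I_n -> R) :
  spec V (fun i => \sum_(j <- r) g j i) = \sum_(j <- r) spec V (g j).
Proof.
elim: r => [|j r IH].
  rewrite big_nil (_ : (fun=> _) = fun=> 0 * 1) ?specZ ?scale0r //.
  by apply/funext => i; rewrite big_nil mul0r.
by rewrite big_cons -IH -specD; congr spec; apply/funext => i; rewrite big_cons.
Qed.

Lemma specX g m : spec V (fun i => g i ^+ m) = spec V g ^+ m.
Proof.
elim: m => [|m IH]; first exact: spec1.
by rewrite exprS -IH; rewrite -[RHS]specM; congr spec; apply/funext => i; rewrite exprS.
Qed.

(** Orthogonal changes of basis preserve the norm, and a diagonal matrix stretches by at most its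
    largest entry. Matrix estimates thereby become scalar estimates on the spectrum. *)
Lemma enorm_spec (c : R) g (x : 'cV[R]_n) : 0 <= c ->
  (forall i, `|g i| <= c) -> enorm (spec V g *m x) <= c * enorm x.
Proof.
move=> c0 gc; rewrite /spec -!mulmxA enorm_orthogonal; last first.
  by rewrite trmxK; exact: mulmx1C.
rewrite -(enorm_orthogonal x VV); apply: enorm_mono => // i.
by rewrite mul_diag_mx !mxE normrM ler_wpM2r.
Qed.

End Spec.

Section MatrixSeries.
Local Open Scope classical_set_scope.

(** A neighbourhood of a matrix contains a product of neighbourhoods of its entries, and there are
    finitely many of them to intersect. *)
Lemma mx_cvg (R : realType) m n (f : nat -> 'M[R]_(m, n)) (M : 'M[R]_(m, n)) :
  (forall i j, f k i j @[k --> \oo] --> M i j) -> f @ \oo --> M.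
Proof.
move=> h A [P MP sPA].
have F i j : \forall k \near \oo, P i j (f k i j) by exact: (h i j _ (MP i j)).
have F' := filter_forall eventually_filter
  (fun i => filter_forall eventually_filter (F i)).
exact: (@filterS nat \oo eventually_filter _ _ (fun k => @sPA (f k)) F').
Qed.

(** Each entry of [spec V h] is a fixed linear combination of the values of [h], so the scalar
    exponential series can be summed eigenvalue by eigenvalue. *)
Lemma expmx_spec (R : realType) n (V : 'M[R]_n) (g : 'I_n -> R) :
  V^T *m V = 1%:M -> expmx (spec V g) = spec V (fun i => expR (g i)).
Proof.
move=> VV; rewrite /expmx; apply: (@cvg_lim _ (@norm_hausdorff _ _)).
apply: mx_cvg => i j.
have E (h : 'I_n -> R) : spec V h i j = \sum_l V l i * V l j * h l.
  rewrite /spec mul_mx_diag mxE; apply: eq_bigr => l _.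
  by rewrite !mxE mulrAC.
rewrite E.
under eq_cvg => k.
  rewrite /series /= (eq_bigr (fun m => spec V (fun i => exp_coeff (g i) m))); last first.
    move=> m _; rewrite /exp_coeff /= -specX // -specZ; congr spec.
    by apply/funext => l; rewrite mulrC.
  rewrite -spec_sum E.
  over.
have H := @cvg_big R 'I_n +%R 0 xpredT (@add_continuous R) nat \oo
  (index_enum _) (fun l k => V l i * V l j * series (exp_coeff (g l)) k)
  (fun l => V l i * V l j * expR (g l)) eventually_filter.

apply: H => l _.
apply: cvgM; first exact: cvg_cst.
exact: is_cvg_series_exp_coeff.
Qed.

End MatrixSeries.

Lemma psd_spectral (R : realType) n (A : 'M[R]_n) : psd A ->
  exists (V : 'M[R]_n) (d : 'I_n -> R),
    [/\ V^T *m V = 1%:M, A = spec V d & forall i, 0 <= d i].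
Proof.
move=> [symA posA]; have [V [d [VV AE]]] := spectral_real symA.
exists V, (d 0); split=> //.
  by rewrite /spec AE; congr (_ *m diag_mx _ *m _); apply/rowP => i; rewrite mxE.
move=> i; have VV' : V *m V^T = 1%:M by exact: mulmx1C.
(* Positivity is tested on the i-th eigenvector, where the quadratic form equals [d i]. *)
have := posA (V^T *m delta_mx i 0).
rewrite trmx_mul trmxK AE !mulmxA -[_ *m V *m V^T]mulmxA VV' mulmx1.
rewrite -(mulmxA _ V) VV' mulmx1 trmx_delta -rowE -colE !mxE eqxx.
by rewrite mulr1n.
Qed.

(** * Polynomial approximation of the exponential *)

(** The terms of the series of exp (mu M); their ratio mu M / (j + 1) has the same shape as the
    recurrence for the coefficients. *)
Definition bnd (R : realType) (mu : R) (M j : nat) : R :=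
  (mu * M%:R) ^+ j / j`!%:R.

Lemma bnd_gt0 (R : realType) (mu : R) (M j : nat) : 0 < mu -> (0 < M)%N -> 0 < bnd mu M j.
Proof. by move=> mu0 M0; rewrite divr_gt0 ?exprn_gt0 ?mulr_gt0 ?ltr0n ?fact_gt0. Qed.

Lemma bndS (R : realType) (mu : R) (M j : nat) :
  j.+1%:R * bnd mu M j.+1 = mu * M%:R * bnd mu M j.
Proof.
rewrite /bnd factS natrM exprS.
have : j.+1%:R != 0 :> R by rewrite pnatr_eq0.
have : j`!%:R != 0 :> R by rewrite pnatr_eq0 -lt0n fact_gt0.
move: (j.+1%:R) (j`!%:R) (M%:R) => a f m f0 a0; field.
by rewrite f0 a0.
Qed.

(** Majorant induction for a two-term recurrence with coefficients p M and q M: the ratio mu works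
    as soon as p mu + q <= mu^2. The bound on the older term is scaled by mu M, so that index 0,
    which has no predecessor, is no special case. *)
Lemma bnd_step (R : realType) (p q mu kappa a1 a a0 : R) (M j : nat) :
  0 <= q -> 0 < mu -> p * mu + q <= mu ^+ 2 -> 0 <= kappa -> (j <= M)%N ->
  (0 < M)%N -> 0 <= p ->
  a <= kappa * bnd mu M j -> mu * M%:R * a0 <= kappa * (j%:R * bnd mu M j) ->
  j.+1%:R * a1 <= p * M%:R * a + q * M%:R * a0 ->
  a1 <= kappa * bnd mu M j.+1.
Proof.
move=> q0 mu0 pq k0 jM M0 p0 ha ha0 h1.
have j0 : 0 < j.+1%:R :> R by rewrite ltr0n.
rewrite -(ler_pM2l j0) mulrCA bndS; apply: le_trans h1 _.
have M0' : 0 < M%:R :> R by rewrite ltr0n.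
have b0 := bnd_gt0 j mu0 M0.
rewrite -(ler_pM2l mu0).
have h2 : p * M%:R * a * mu <= p * M%:R * (kappa * bnd mu M j) * mu.
  by rewrite ler_wpM2r ?(ltW mu0) // ler_wpM2l // mulr_ge0 // ltW.
have h3 : q * (mu * M%:R * a0) <= q * (kappa * (j%:R * bnd mu M j)).
  by rewrite ler_wpM2l.
have h4 : q * (kappa * (j%:R * bnd mu M j)) <= q * (kappa * (M%:R * bnd mu M j)).
  by rewrite ler_wpM2l // ler_wpM2l // ler_wpM2r ?(ltW b0) // ler_nat.
have h5 : (p * mu + q) * (M%:R * (kappa * bnd mu M j)) <= mu ^+ 2 * (M%:R * (kappa * bnd mu M j)).
  by rewrite ler_wpM2r // mulr_ge0 ?(ltW M0') // mulr_ge0 // ltW.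
move: (bnd mu M j) h2 h3 h4 h5 => b h2 h3 h4 h5; rewrite expr2 in h5; lra.
Qed.

Lemma bnd_prev (R : realType) (mu kappa a : R) (M j : nat) : 0 < mu -> (0 < M)%N ->
  a <= kappa * bnd mu M j ->
  mu * M%:R * a <= kappa * (j.+1%:R * bnd mu M j.+1).
Proof.
move=> mu0 M0 h; rewrite bndS mulrCA ler_wpM2l // mulr_ge0 ?ler0n //.
exact: ltW.
Qed.

Lemma bnd_le (R : realType) (mu : R) (M j : nat) : 0 <= mu ->
  bnd mu M j <= mu ^+ j * expR M%:R.
Proof.
move=> mu0; rewrite /bnd exprMn -mulrA ler_wpM2l ?exprn_ge0 //.
case: j => [|j]; first by rewrite expr0 fact0 divr1 (le_trans _ (expR_ge1Dx _)) // lerDl ler0n.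
by apply: le_trans (expR_ge1Dxn j (ler0n R M)); rewrite lerDr.
Qed.

(* Taylor coefficients of (1 - z)^-N exp(- (N + M) z / (1 - z)), that is, the
   values at N + M of the generalized Laguerre polynomials of parameter N - 1. *)
Fixpoint lag2 (R : realType) (M N j : nat) : R * R :=
  if j is i.+1 then
    let: (c, c0) := lag2 R M N i in
    (((2 * i%:R - M%:R) * c - (N.-1 + i)%:R * c0) / i.+1%:R, c)
  else (1, 0).

Definition lag (R : realType) (M N j : nat) : R := (lag2 R M N j).1.

Lemma lagS (R : realType) (M N j : nat) :
  j.+1%:R * lag R M N j.+1 =
  (2 * j%:R - M%:R) * lag R M N j - (N.-1 + j)%:R * (lag2 R M N j).2.
Proof.
rewrite /lag /=; case: (lag2 R M N j) => c c0 /=.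
by rewrite mulrC divfK // pnatr_eq0.
Qed.

Lemma lag2S (R : realType) (M N j : nat) : (lag2 R M N j.+1).2 = lag R M N j.
Proof. by rewrite /lag /=; case: (lag2 R M N j). Qed.

Lemma lag_coef_le (R : realType) (M j : nat) : (j <= M)%N ->
  `|2 * j%:R - M%:R| <= M%:R :> R.
Proof.
move=> jM; have : j%:R <= M%:R :> R by rewrite ler_nat.
have := ler0n R j; rewrite ler_norml => h1 h2; apply/andP; split; lra.
Qed.

(** For a step from j < M the recurrence has coefficients at most M and 4 M in absolute value, and
    8/3 + 4 <= (8/3)^2. *)
Lemma lag_bnd (R : realType) (M N j : nat) : (0 < M)%N ->
  (N.-1 + M <= 4 * M + 1)%N -> (j <= M)%N ->
  `|lag R M N j| <= bnd (8/3) M j /\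
  8/3 * M%:R * `|(lag2 R M N j).2| <= j%:R * bnd (8/3) M j.
Proof.
move=> M0 NM; elim: j => [|j IH] jM.
  by rewrite /bnd /lag /= normr1 normr0 !mulr0 mul0r expr0 divr1.
have [h1 h2] := IH (ltnW jM).
have mu0 : 0 < 8 / 3 :> R by lra.
split; last first.
  by rewrite lag2S -[leRHS]mul1r; apply: bnd_prev; rewrite // mul1r.
rewrite -[leRHS]mul1r.
apply: (@bnd_step _ 1 4 _ _ _ `|lag R M N j| `|(lag2 R M N j).2|); rewrite ?mul1r //; try lra.
  exact: ltnW.
rewrite -[j.+1%:R]ger0_norm ?ler0n // -normrM lagS.
rewrite (le_trans (ler_normB _ _)) // !normrM lerD //.
  by rewrite ler_wpM2r // lag_coef_le // ltnW.
rewrite ler_wpM2r // ger0_norm ?ler0n // -natrM ler_nat.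
by move: NM jM; lia.
Qed.

(** The full series G satisfies (1 - z)^2 G' + (M + N z) G = 0. For the truncation, the recurrence
    still cancels all degrees below J; adding a term moves the defect up by one degree. *)
Lemma lag_ode (R : realType) (M N J : nat) (z : R) : (0 < N)%N ->
  (1 - z) ^+ 2 * (\poly_(j < J.+1) lag R M N j)^`().[z] +
    (M%:R + N%:R * z) * (\poly_(j < J.+1) lag R M N j).[z] =
  (J + N)%:R * lag R M N J * z ^+ J.+1 - J.+1%:R * lag R M N J.+1 * z ^+ J.
Proof.
move=> N0; elim: J => [|J IH].
  rewrite poly_def big_ord1 expr0 alg_polyC derivC horner0 hornerC lagS.
  rewrite /lag /= add0n; ring.
have -> : \poly_(j < J.+2) lag R M N j =
    \poly_(j < J.+1) lag R M N j + lag R M N J.+1 *: 'X^(J.+1).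
  by rewrite !poly_def big_ord_recr.
rewrite derivD derivZ derivXn !hornerD !hornerZ hornerMn hornerXn /= -mulr_natl.
rewrite !mulrDr addrACA IH [in RHS]lagS lag2S.
rewrite (_ : N.-1 + J.+1 = J + N)%N; last by lia.
rewrite hornerXn !exprS !natrD -[J.+1%:R]natr1.
ring.
Qed.

(** The maximum is at z = 1/4, which is therefore a double root of the difference. *)
Lemma amgm_27_256 (R : realDomainType) (z : R) :
  256 * (z * (1 - z) ^+ 3) <= 27.
Proof.
rewrite -subr_ge0.
have -> : 27 - 256 * (z * (1 - z) ^+ 3) =
    (4 * z - 1) ^+ 2 * ((4 * z - 5) ^+ 2 + 2) by ring.
by rewrite mulr_ge0 ?sqr_ge0 // addr_ge0 ?sqr_ge0.
Qed.

(** The bound is (4/3)^4, from 1 - 1/4 <= exp (- 1/4). It is tuned to the rate: 27/256 * 8/3 *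
    256/81 = 8/9. *)
Lemma expR1_le (R : realType) : expR 1 <= 256 / 81 :> R.
Proof.
have h1 := expR_ge1Dx (- (1 / 4) : R).
have : (3 / 4 : R) ^+ 4 <= expR (- (1 / 4)) ^+ 4.
  by rewrite lerXn2r ?nnegrE ?expR_ge0 //; lra.
rewrite -expRM_natl -mulr_natl.
rewrite (_ : 4 * - (1 / 4) = - 1 :> R); last by lra.
have e0 : 0 < expR 1 :> R by exact: expR_gt0.
rewrite expRN => h2; rewrite -[leLHS]invrK.
rewrite (_ : 256 / 81 = ((3 / 4) ^+ 4)^-1); last by field.
by rewrite lef_pV2 ?posrE ?invr_gt0 ?exprn_gt0 //; lra.
Qed.

(** [E] is the ratio of the approximant to its target exp (- h), so the error is exp (- h z) |E z -
    1|. As E 0 = 1, the mean value theorem bounds it by the derivative at some c <= z, where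
    [lag_ode] leaves two terms. *)
Lemma lag_approx (R : realType) (M N : nat) (z : R) : (0 < M)%N ->
  (3 * M <= N.+1)%N -> (N <= 3 * M + 2)%N -> 0 <= z < 1 ->
  `|expR (- ((N + M)%:R * z / (1 - z))) -
    (1 - z) ^+ N * (\poly_(j < M) lag R M N j).[z]| <=
  60 * M%:R * (8 / 9) ^+ M.
Proof.
case: M => // m _ hN1 hN2 /andP[z0 z1]; pose M := m.+1; rewrite -/M in hN1 hN2 *.
have NM : (N.-1 + M <= 4 * M + 1)%N by rewrite /M in hN2 *; lia.
have mN5 : (m + N <= 5 * M)%N by rewrite /M in hN2 *; lia.
(* Differentiating exp (h) costs (1 - x)^-2; the N - 2 remaining factors 1 - x are still at least 3
   (M - 1). *)
have [N2 NE] : exists N2, N = N2.+2 by exists (N - 2)%N; rewrite /M in hN1; lia.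
have mN2 : (3 * m <= N2)%N by move: hN1; rewrite NE /M; lia.
pose k : R := (N + M)%:R.
pose q := \poly_(j < M) lag R M N j.
pose P := q * (1 - 'X) ^+ N.
pose h (x : R) := k / (1 - x) - k.
pose E (x : R) := P.[x] * expR (h x).
pose bra (x : R) := (m + N)%:R * lag R M N m * x ^+ M - M%:R * lag R M N M * x ^+ m.
pose dE (x : R) := (1 - x) ^+ N2 * bra x * expR (h x).
have derE (x : R) : x < 1 -> is_derive x 1 E (dE x).
  move=> x1; have x10 : 1 - x != 0 by rewrite subr_eq0 gt_eqF.
  have dh : is_derive x 1 h (k / (1 - x) ^+ 2).
    have dl : is_derive x 1 (fun y : R => 1 - y) (-1).
      have -> : (fun y : R => 1 - y) = cst 1 - id by apply/funext.
      by apply: is_derive_eq; rewrite sub0r.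
    have -> : h = k \*: (fun y : R => (1 - y)^-1) - cst k by apply/funext.
    have dv : is_derive x 1 (fun y : R => (1 - y)^-1) ((1 - x) ^- 2).
      apply: (is_derive_eq (@is_deriveV _ (fun y : R => 1 - y) x (-1) 1 x10 dl)).
      by rewrite scalerN scaleNr opprK; exact: mulr1.
    by apply: is_derive_eq; rewrite subr0.
  have dexp : is_derive x 1 (expR \o h) (k / (1 - x) ^+ 2 * expR (h x)).
    by apply: is_derive_eq; rewrite mulrC.
  rewrite (_ : E = horner P * (expR \o h : R -> R)); last by apply/funext.
  apply: is_derive_eq; rewrite /dE /bra -lag_ode; last by lia.
  rewrite -/M -/q.
  have PE : P.[x] = q.[x] * (1 - x) ^+ N by rewrite /P hornerM horner_exp !hornerE.
  have dP : P^`().[x] =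
      q^`().[x] * (1 - x) ^+ N - N%:R * q.[x] * (1 - x) ^+ N.-1.
    rewrite /P derivM deriv_exp derivB derivC derivX sub0r hornerD hornerM.
    rewrite hornerM hornerMn hornerM !horner_exp hornerD !hornerN hornerX hornerC.
    by rewrite -mulr_natl; ring.
  change (P.[x] * (k / (1 - x) ^+ 2 * expR (h x)) + expR (h x) * P^`().[x] =
    (1 - x) ^+ N2 * ((1 - x) ^+ 2 * q^`().[x] + (M%:R + N%:R * x) * q.[x]) * expR (h x)).
  have -> : k = N%:R + M%:R by rewrite /k natrD.
  rewrite PE dP (_ : (1 - x) ^+ N = (1 - x) ^+ 2 * (1 - x) ^+ N2).
    rewrite (_ : (1 - x) ^+ N.-1 = (1 - x) * (1 - x) ^+ N2).
      move: (expR _) (q.[x]) (q^`().[x]) ((1 - x) ^+ N2) => e0 q0 q1 r0.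
      by field.
    by rewrite NE /= exprS.
  by rewrite NE -exprD.
have [c cz EE] : exists2 c, c \in `[0, z] & E z - E 0 = dE c * (z - 0).
  apply: MVT_segment => //.
    by move=> x /itvP xI; apply: derE; rewrite (lt_trans _ z1) // xI.
  apply: derivable_within_continuous => x /itvP xI.
  by apply: ex_derive; apply: derE; rewrite (le_lt_trans _ z1) // xI.
have E0 : E 0 = 1.
  rewrite /E /h /P subr0 divr1 subrr expR0 mulr1 hornerM horner_exp !hornerE.
  by rewrite subr0 expr1n mulr1 horner_coef0 coef_poly.
have EE' : E z - 1 = dE c * z by rewrite -E0 EE subr0.
have [c0 cle] : 0 <= c /\ c <= z by split; rewrite (itvP cz).
have hE (x : R) : x < 1 -> h x = k * x / (1 - x).
  by move=> x1; rewrite /h; field; rewrite subr_eq0 gt_eqF.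
(* Monotonicity of [h] lets exp (- h z) absorb exp (h c), which keeps the bound uniform although [h]
   is unbounded near 1. *)
have hcz : h c <= h z.
  rewrite /h lerD2r ler_wpM2l ?ler0n // lef_pV2 ?posrE ?subr_gt0 //; lra.
have -> : (1 - z) ^+ N * q.[z] = E z * expR (- h z).
  by rewrite /E -mulrA -expRD subrr expR0 mulr1 /P hornerM horner_exp !hornerE mulrC.
rewrite -/k -hE // -[X in `|X - _|]mul1r -mulrBl normrM distrC EE'.
rewrite (gtr0_norm (expR_gt0 _)).
have c1 : 0 <= 1 - c by lra.
have e3 := expR1_le R.
have [lm _] := @lag_bnd R M N m isT NM (leqnSn m).
have [lM _] := @lag_bnd R M N M isT NM (leqnn M).
have {}lm := le_trans lm (bnd_le M m (ltW (_ : 0 < 8 / 3 :> R))).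
have {}lM := le_trans lM (bnd_le M M (ltW (_ : 0 < 8 / 3 :> R))).
have {}lm : `|lag R M N m| <= (8 / 3) ^+ m * expR M%:R by apply: lm; lra.
have {}lM : `|lag R M N M| <= (8 / 3) ^+ M * expR M%:R by apply: lM; lra.
(* The two terms contribute 5 M and 8/3 M, together at most 8 M. *)
have hbra : `|bra c| <= c ^+ m * (8 * M%:R * ((8 / 3) ^+ m * expR M%:R)).
  have cm0 : 0 <= c ^+ m by rewrite exprn_ge0.
  have mN : (m + N)%:R <= 5 * M%:R :> R by rewrite -natrM ler_nat.
  have h1 : `|(m + N)%:R * lag R M N m * c ^+ M| <=
      5 * M%:R * ((8 / 3) ^+ m * expR M%:R) * c ^+ m.
    rewrite !normrM (ger0_norm (ler0n _ _)) (ger0_norm (exprn_ge0 M c0)).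
    apply: ler_pM; rewrite ?mulr_ge0 ?normr_ge0 ?exprn_ge0 //.
      by apply: ler_pM; rewrite ?ler0n.
    by rewrite /M exprS ler_piMl ?exprn_ge0 //; lra.
  have h2 : `|M%:R * lag R M N M * c ^+ m| <=
      M%:R * (8 / 3 * ((8 / 3) ^+ m * expR M%:R)) * c ^+ m.
    rewrite !normrM (ger0_norm (ler0n _ _)) (ger0_norm cm0).
    by rewrite ler_wpM2r // ler_wpM2l ?ler0n // mulrA -exprS.
  rewrite (le_trans (ler_normB _ _)) // (le_trans (lerD h1 h2)) //.
  rewrite -subr_ge0.
  have X0 : 0 <= c ^+ m * M%:R * ((8 / 3) ^+ m * expR M%:R).
    by rewrite !mulr_ge0 ?expR_ge0 ?ler0n // exprn_ge0 //; lra.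
  move: X0; set X := _ * expR _; set Y := M%:R; set Z := c ^+ m; nra.
have hpow : (1 - c) ^+ N2 * c ^+ m <= (27 / 256) ^+ m.
  have c1' : 1 - c <= 1 by lra.
  apply: (@le_trans _ _ ((1 - c) ^+ (3 * m) * c ^+ m)).
    by rewrite ler_wpM2r ?exprn_ge0 // ler_wiXn2l.
  rewrite mulrC exprM -exprMn; apply: lerXn2r; rewrite ?nnegrE.
  - by rewrite mulr_ge0 // exprn_ge0.
  - lra.
  - by have := amgm_27_256 c; lra.
rewrite !normrM (ger0_norm (expR_ge0 _)) (ger0_norm z0).
rewrite (ger0_norm (exprn_ge0 _ c1)).
have zc : expR (- h z) * expR (h c) <= 1.
  by rewrite -expRD -expR0 ler_expR; lra.
have T0 : 0 <= (1 - c) ^+ N2 * `|bra c| by rewrite mulr_ge0 ?exprn_ge0.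
apply: (@le_trans _ _ ((1 - c) ^+ N2 * `|bra c|)).
  rewrite -[leRHS]mul1r -[leRHS]mulr1.
  rewrite [leLHS](_ : _ =
     expR (- h z) * expR (h c) * ((1 - c) ^+ N2 * `|bra c|) * z); last by ring.
  by rewrite ler_pM ?mulr_ge0 ?expR_ge0 ?exprn_ge0 // ?ler_wpM2r //; lra.
apply: (@le_trans _ _ ((27 / 256) ^+ m * (8 * M%:R * ((8 / 3) ^+ m * expR M%:R)))).
  apply: le_trans (ler_wpM2l (exprn_ge0 _ c1) hbra) _.
  rewrite [leLHS]mulrA; apply: ler_wpM2r; last exact: hpow.
  by rewrite !mulr_ge0 ?expR_ge0 ?ler0n // exprn_ge0 //; lra.
have -> : expR M%:R = expR 1 ^+ M :> R by rewrite -expRM_natl mulr1.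
rewrite (_ : _ ^+ m * _ =
  8 * M%:R * (((27 / 256) * (8 / 3) * expR 1) ^+ m * expR 1)); last first.
  by rewrite !exprMn /M exprS; ring.
(* 60 * 8/9 = 8 * 20/3; the factor 20/3 pays for the single e left over when e^M meets only M - 1
   factors of the other kind. *)
rewrite [leRHS](_ : _ = 8 * M%:R * ((8 / 9) ^+ m * (20 / 3))); last first.
  have -> : (8 / 9) ^+ M = 8 / 9 * (8 / 9) ^+ m :> R by exact: exprS.
  by move: (_ ^+ m) (M%:R) => a b; field.
apply: ler_wpM2l; first by rewrite mulr_ge0 ?ler0n.
have e0 := expR_ge0 (1 : R).
move: e0 e3; clear => e0 e3.
apply: ler_pM; [by apply: exprn_ge0; lra | exact: e0 | | by lra].
by apply: lerXn2r; rewrite ?nnegrE; lra.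
Qed.

(** The constant 1000 forces M >= 234 L, hence M / 18 >= L + 12. As 8/9 <= exp (- 1/9), the power is
    at most the square of exp (- M / 18): one copy absorbs the factor M at the price of 18, the
    other gives eps / 2^12, and 60 * 18 <= 2^11. *)
Lemma rate_le (R : realType) (M k : nat) (eps : R) : 0 < eps ->
  (k <= 4 * M + 2)%N -> 1000 * Num.max (ln eps^-1) 1 <= k%:R ->
  60 * M%:R * (8 / 9) ^+ M <= eps / 2.
Proof.
move=> eps0 kM hk; set L := Num.max _ _ in hk.
have L1 : 1 <= L by rewrite /L le_max lexx orbT.
have lnL : ln eps^-1 <= L by rewrite /L le_max lexx.
have hM : 234 * L <= M%:R.
  have : k%:R <= 4 * M%:R + 2 :> R by rewrite -natrM -natrD ler_nat.
  by move: hk; lra.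
have h1 : (8 / 9) ^+ M <= expR (- (M%:R / 18)) ^+ 2 :> R.
  have -> : expR (- (M%:R / 18)) ^+ 2 = expR (- (1 / 9)) ^+ M :> R.
    by rewrite -!expRM_natl; congr expR; field.
  apply: lerXn2r; rewrite ?nnegrE ?expR_ge0 //.
  by have := expR_ge1Dx (- (1 / 9) : R); lra.
have h2 : M%:R * expR (- (M%:R / 18)) <= 18 :> R.
  rewrite expRN ler_pdivrMr ?expR_gt0 //.
  by have := expR_ge1Dx (M%:R / 18 : R); lra.
have h3 : expR (- (M%:R / 18)) <= eps * (1 / 16 * (1 / 16) * (1 / 16)).
  have -> : eps = expR (- ln eps^-1) by rewrite lnV ?posrE // opprK lnK.
  have e1 : expR (- 1) <= 1 / 2 :> R.
    rewrite expRN div1r lef_pV2 ?posrE ?expR_gt0 //.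
    by have := expR_ge1Dx (1 : R); lra.
  have e4 : expR (- 4) <= 1 / 16 :> R.
    have -> : - 4 = 4 * - 1 :> R by ring.
    rewrite expRM_natl (_ : 1 / 16 = (1 / 2) ^+ 4 :> R); last by field.
    by apply: lerXn2r; rewrite ?nnegrE ?expR_ge0 //; lra.
  have h4 : expR (- 12) <= 1 / 16 * (1 / 16) * (1 / 16) :> R.
    have -> : - 12 = - 4 + - 4 + - 4 :> R by ring.
    rewrite !expRD; do 2?[apply: ler_pM]; rewrite ?mulr_ge0 ?expR_ge0 //.
  apply: le_trans (ler_wpM2l (expR_ge0 _) h4).
  by rewrite -expRD ler_expR; lra.
have e0 := expR_ge0 (- (M%:R / 18) : R).
move: h1 h2 h3 e0; rewrite expr2; set Y := expR _; set X := _ ^+ M.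
set m := M%:R => h1 h2 h3 Y0.
have m0 : 0 <= m by rewrite /m ler0n.
have : m * X <= m * (Y * Y) by rewrite ler_wpM2l.
have : m * Y * Y <= 18 * Y by rewrite ler_wpM2r.
by lra.
Qed.

(** The substitution z = 1 - t maps the unbounded half-line of [lam] into [0, 1), with k z / (1 - z)
    = lam. *)
Lemma scalar_approx (R : realType) (M N : nat) (eps lam : R) : (0 < M)%N ->
  (3 * M <= N.+1)%N -> (N <= 3 * M + 2)%N -> 0 < eps ->
  1000 * Num.max (ln eps^-1) 1 <= (N + M)%:R -> 0 <= lam ->
  let t := (1 + (N + M)%:R^-1 * lam)^-1 in
  `|expR (- lam) - t ^+ N * \sum_(j < M) lag R M N j * (1 - t) ^+ j| <= eps / 2.
Proof.
move=> M0 hN1 hN2 eps0 hk lam0 /=; set t := (1 + _)^-1.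
have NM : (N + M <= 4 * M + 2)%N by move: hN2; clear; lia.
have k0 : 0 < (N + M)%:R :> R by rewrite ltr0n addn_gt0 M0 orbT.
have d0 : 0 < 1 + (N + M)%:R^-1 * lam.
  by rewrite ltr_pwDl // mulr_ge0 // invr_ge0 ltW.
have t0 : 0 < t by rewrite invr_gt0.
have t1 : t <= 1.
  by rewrite invf_le1 // lerDl mulr_ge0 // invr_ge0 ltW.
have zI : 0 <= 1 - t < 1 by apply/andP; split; lra.
have := @lag_approx R M N (1 - t) M0 hN1 hN2 zI.
rewrite horner_poly subKr.
have -> : (N + M)%:R * (1 - t) / t = lam.
  rewrite /t; field; rewrite !gt_eqF //=; lra.
move=> /le_trans; apply; apply: rate_le hk => //.
Qed.

(** * The program *)

Definition block (l : seq instr) : prog :=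
  foldr (fun c p => Seq (Instr c) p) Skip l.

Arguments block : simpl never.

(* Registers: integer 2 = 1, 3 = 4, 4 = 6, 6 = M, 7 = j, 8 = i, 9 = 0,
   11 = 2n, 16 = N - 1 + j; floating-point 2 = c_j, 3 = c_(j-1).
   Heap: (1 - S)^j x at 0, the partial sum at n, scratch at 2n.  The last call of the
   [taylor] loop is wasted, so that the M + N = k calls produce degree k - 1. *)
Definition setup : prog :=
  block [:: IConst 2 1; IConst 3 4; IConst 4 6; IAdd 5 1 9; IConst 6 1;
            IAdd 11 0 0; FOfNat 2 2].

(** Integer division by repeated subtraction, in O(k) steps: it stops with k - 4 (M - 1) between 3
    and 6, so that N = k - M lies between 3 M - 1 and 3 M + 2. *)
Definition divide : prog :=
  While (ILt 4 5) (block [:: ISub 5 5 3; IAdd 6 6 2]).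

(** A single sweep adds c_j v to the partial sum and replaces v by v - w, where w is the vector just
    returned by the solver; the old v_i stays in a register for both uses. *)
Definition axpy : prog :=
  While (ILt 8 0)
    (block [:: FLoad 4 8; IAdd 10 0 8; FLoad 5 10; IAdd 12 11 8; FLoad 7 12;
               FArith Mul 6 2 4; FArith Add 5 5 6; FStore 10 5;
               FArith Defs.Sub 4 4 7; FStore 8 4; IAdd 8 8 2]).

(** Integer subtraction truncates, so the signed number 2 j - M is the floating-point difference of
    two truncated ones, one of which is 0. Its rounding error is therefore purely relative. *)
Definition next_coef : prog :=
  Seq (block [:: IAdd 13 7 7; ISub 14 13 6; ISub 15 6 13; FOfNat 4 14;
                 FOfNat 5 15; FArith Defs.Sub 4 4 5; FArith Mul 4 4 2])
  (Seq (block [:: FOfNat 5 16; FArith Mul 5 5 3; FArith Defs.Sub 4 4 5;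
                  FMove 3 2; IAdd 7 7 2])
       (block [:: FOfNat 5 7; FArith Div 2 4 5; IAdd 16 16 2])).

Definition taylor : prog :=
  Seq (block [:: Call 11 9; IConst 8 0]) (Seq axpy next_coef).

(** The first call reads the partial sum at n and writes at 0, where the output belongs; the later
    calls work in place. *)
Definition power : prog :=
  While (ILt 7 1) (block [:: Call 9 17; IConst 17 0; IAdd 7 7 2]).

Definition exp_prog : prog :=
  Seq setup (Seq divide (Seq (block [:: ISub 16 1 6; ISub 16 16 2])
    (Seq (While (ILt 7 6) taylor) (Seq (block [:: IAdd 17 0 9]) power)))).

(** * Total-correctness rules for symbolic execution *)

Section Runs.
Variables (R : realType) (n : nat).
Variables (solver : nat -> 'cV[R]_n -> 'cV[R]_n) (delta : nat -> R).
Implicit Types (p q : prog) (s : state R) (Q : state R -> Prop).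

Definition runs p s Q : Prop := exists2 s', exec solver delta p s s' & Q s'.

Lemma runs_seq p q s Q : runs p s (fun s1 => runs q s1 Q) -> runs (Seq p q) s Q.
Proof. by move=> [s1 e1 [s2 e2 Q2]]; exists s2 => //; apply: ExecSeq e1 e2. Qed.

Lemma runs_imp p s Q Q' : runs p s Q -> (forall s', Q s' -> Q' s') -> runs p s Q'.
Proof. by move=> [s1 e1 Q1] h; exists s1 => //; apply: h. Qed.

(** The number K of iterations is known beforehand and the invariant, indexed by the iteration,
    decides the test; termination is an induction on K - i. *)
Lemma runs_while t p (K : nat) (I : nat -> state R -> Prop) s Q :
  (forall i s1, (i < K)%N -> I i s1 ->
     eval_test t s1 /\ runs p (tick s1) (I i.+1)) ->
  (forall s1, I K s1 -> ~~ eval_test t s1 /\ Q (tick s1)) ->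
  forall i, (i <= K)%N -> I i s -> runs (While t p) s Q.
Proof.
move=> hs hd i iK; rewrite -(subKn iK); move: (K - i)%N (leq_subr i K) => d.
elim: d s => [|d IH] s dK.
  by rewrite subn0 => /hd[tF Qs]; exists (tick s) => //; exact: ExecWhileDone.
move=> Is; have lt : (K - d.+1 < K)%N by rewrite ltn_subrL /=; lia.
have [tT [s1 e1 I1]] := hs _ _ lt Is.
rewrite -subSn // subSS in I1.
have [s2 e2 Q2] := IH s1 (ltnW dK) I1.
by exists s2 => //; apply: ExecWhileStep e1 e2.
Qed.

End Runs.

Section Rules.
Variables (R : realType) (n : nat).
Variables (solver : nat -> 'cV[R]_n -> 'cV[R]_n) (delta : nat -> R).
Variables (Q : state R -> Prop) (l : seq instr).
Variables (ir ih : nat -> nat) (fr fh : nat -> R) (tm nc : nat).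

Let run l s := runs solver delta (block l) s Q.

Lemma runs_cons c s s1 : exec_instr solver delta c s = Some s1 ->
  run l s1 -> run (c :: l) s.
Proof. by move=> e h; apply: runs_seq; exists s1 => //; exact: ExecInstr. Qed.

Lemma runs_nil s : Q s -> run [::] s.
Proof. by exists s => //; exact: ExecSkip. Qed.

(* The value written is abstracted, lest the size of the symbolic state grow
   exponentially with the length of the block. *)
Lemma runs_iconst d c :
  (forall v, v = c -> run l (State (upd ir d v) ih fr fh tm.+1 nc)) ->
  run (IConst d c :: l) (State ir ih fr fh tm nc).
Proof. by move=> h; apply: runs_cons (h _ erefl). Qed.

Lemma runs_iadd d a b :
  (forall v, v = (ir a + ir b)%N ->
    run l (State (upd ir d v) ih fr fh tm.+1 nc)) ->
  run (IAdd d a b :: l) (State ir ih fr fh tm nc).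
Proof. by move=> h; apply: runs_cons (h _ erefl). Qed.

Lemma runs_isub d a b :
  (forall v, v = (ir a - ir b)%N ->
    run l (State (upd ir d v) ih fr fh tm.+1 nc)) ->
  run (ISub d a b :: l) (State ir ih fr fh tm nc).
Proof. by move=> h; apply: runs_cons (h _ erefl). Qed.

Lemma runs_fmove d a :
  (forall v, v = fr a -> run l (State ir ih (upd fr d v) fh tm.+1 nc)) ->
  run (FMove d a :: l) (State ir ih fr fh tm nc).
Proof. by move=> h; apply: runs_cons (h _ erefl). Qed.

Lemma runs_fload d a :
  (forall v, v = fh (ir a) -> run l (State ir ih (upd fr d v) fh tm.+1 nc)) ->
  run (FLoad d a :: l) (State ir ih fr fh tm nc).
Proof. by move=> h; apply: runs_cons (h _ erefl). Qed.

Lemma runs_fstore a b :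
  (forall c v, c = ir a -> v = fr b ->
    run l (State ir ih fr (upd fh c v) tm.+1 nc)) ->
  run (FStore a b :: l) (State ir ih fr fh tm nc).
Proof. by move=> h; apply: runs_cons (h _ _ erefl erefl). Qed.

Lemma runs_fofnat d a :
  (forall v, v = (1 + delta tm) * (ir a)%:R ->
    run l (State ir ih (upd fr d v) fh tm.+1 nc)) ->
  run (FOfNat d a :: l) (State ir ih fr fh tm nc).
Proof. by move=> h; apply: runs_cons (h _ erefl). Qed.

Lemma runs_fadd d a b :
  (forall v, v = (1 + delta tm) * (fr a + fr b) ->
    run l (State ir ih (upd fr d v) fh tm.+1 nc)) ->
  run (FArith Add d a b :: l) (State ir ih fr fh tm nc).
Proof. by move=> h; apply: runs_cons (h _ erefl). Qed.

Lemma runs_fsub d a b :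
  (forall v, v = (1 + delta tm) * (fr a - fr b) ->
    run l (State ir ih (upd fr d v) fh tm.+1 nc)) ->
  run (FArith Defs.Sub d a b :: l) (State ir ih fr fh tm nc).
Proof. by move=> h; apply: runs_cons (h _ erefl). Qed.

Lemma runs_fmul d a b :
  (forall v, v = (1 + delta tm) * (fr a * fr b) ->
    run l (State ir ih (upd fr d v) fh tm.+1 nc)) ->
  run (FArith Mul d a b :: l) (State ir ih fr fh tm nc).
Proof. by move=> h; apply: runs_cons (h _ erefl). Qed.

Lemma runs_fdiv d a b : fr b != 0 ->
  (forall v, v = (1 + delta tm) * (fr a / fr b) ->
    run l (State ir ih (upd fr d v) fh tm.+1 nc)) ->
  run (FArith Div d a b :: l) (State ir ih fr fh tm nc).
Proof.
move=> /negPf b0 h; apply: runs_cons (h _ erefl).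
by rewrite /= b0.
Qed.

Lemma runs_call d a :
  (forall h, h = write_vec fh (ir d) (solver nc (read_vec n fh (ir a))) ->
    run l (State ir ih fr h tm nc.+1)) ->
  run (Call d a :: l) (State ir ih fr fh tm nc).
Proof. by move=> h; apply: runs_cons (h _ erefl). Qed.

End Rules.

Lemma write_vec_in (R : realType) n (h : nat -> R) a (z : 'cV[R]_n) (i : 'I_n) :
  write_vec h a z (a + i) = z i 0.
Proof. by rewrite /write_vec leq_addr addKn valK. Qed.

Lemma write_vec_out (R : realType) n (h : nat -> R) a (z : 'cV[R]_n) j :
  (j < a)%N || (a + n <= j)%N -> write_vec h a z j = h j.
Proof.
rewrite /write_vec; case: leqP => //= aj nj.
by rewrite insubF //=; apply/negbTE; rewrite -leqNgt leq_subRL.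
Qed.

Lemma read_write_vec (R : realType) n (h : nat -> R) a (z : 'cV[R]_n) :
  read_vec n (write_vec h a z) a = z.
Proof. by apply/colP => i; rewrite mxE write_vec_in. Qed.

Definition ctx (R : realType) (n k M : nat) (s : state R) : Prop :=
  [/\ ireg s 0 = n, ireg s 1 = k, ireg s 2 = 1%N, ireg s 6 = M &
      ireg s 9 = 0%N /\ ireg s 11 = (n + n)%N].

(** * Rounding errors of one iteration *)

Section Exec.
Variables (R : realType) (n : nat).
Variables (solver : nat -> 'cV[R]_n -> 'cV[R]_n) (delta : nat -> R).
Variables (u : R).
Hypothesis u_le : u <= 1 / 2.
Hypothesis delta_le : forall t, `|delta t| <= u.

Let u0 : 0 <= u := le_trans (normr_ge0 _) (delta_le 0).

Lemma rnd_err (d x : R) : `|d| <= u -> `|(1 + d) * x - x| <= u * `|x|.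
Proof.
by move=> du; rewrite mulrDl mul1r addrAC subrr add0r normrM ler_wpM2r.
Qed.

Lemma rnd_err2 (d e x y : R) : `|d| <= u -> `|e| <= u ->
  `|(1 + e) * (y + (1 + d) * x) - (y + x)| <= u * `|y| + 3 * u * `|x|.
Proof.
move=> du eu; have -> : (1 + e) * (y + (1 + d) * x) - (y + x) =
  e * y + (e + d + e * d) * x by ring.
rewrite (le_trans (ler_normD _ _)) // !normrM lerD // ?ler_wpM2r //.
rewrite (le_trans (ler_normD _ _)) // normrM.
have : `|e| * `|d| <= u * 1 by rewrite ler_pM //; move: u_le; lra.
by have := ler_normD e d; lra.
Qed.

Lemma rel_mul (p q a b : R) : `|a - 1| <= p * u -> `|b - 1| <= q * u ->
  0 <= p -> 0 <= q -> `|a * b - 1| <= (p + q + p * q) * u.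
Proof.
move=> ha hb p0 q0.
have -> : a * b - 1 = (a - 1) * (b - 1) + ((a - 1) + (b - 1)) by ring.
rewrite (le_trans (ler_normD _ _)) // normrM.
have h1 : `|a - 1| * `|b - 1| <= p * u * (q * 1).
  apply: ler_pM => //; apply: le_trans hb _; rewrite ler_wpM2l //.
  by move: u_le; lra.
by have := ler_normD (a - 1) (b - 1); lra.
Qed.

Lemma rel_inv (d : R) : `|d| <= u -> `|(1 + d)^-1 - 1| <= 2 * u.
Proof.
move=> du; have /andP[d1 d2] : - u <= d <= u by rewrite -ler_norml.
have d0 : 1 / 2 <= 1 + d by move: u_le; lra.
have d00 : 0 < 1 + d by lra.
have -> : (1 + d)^-1 - 1 = - (d / (1 + d)) by field; rewrite gt_eqF.
rewrite normrN normrM normfV (gtr0_norm d00) ler_pdivrMr //.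
by apply: le_trans du _; rewrite -[leLHS]mulr1 -mulrA; nra.
Qed.

(** Appending a rounding turns a constant p into 2 p + 1, whence 1, 3, 7, 15, 31; the quotient has
    constant 2, and 31 + 2 + 62 = 95. *)
Lemma rel_prod (d1 d2 d3 d4 d5 d6 : R) :
  `|d1| <= u -> `|d2| <= u -> `|d3| <= u -> `|d4| <= u -> `|d5| <= u ->
  `|d6| <= u ->
  `|(1 + d1) * (1 + d2) * (1 + d3) * (1 + d4) * (1 + d5) / (1 + d6) - 1|
    <= 95 * u.
Proof.
have r1 d : `|d| <= u -> `|1 + d - 1| <= 1 * u.
  by rewrite addrAC subrr add0r mul1r.
move=> /r1 h1 /r1 h2 /r1 h3 /r1 h4 /r1 h5 /rel_inv h6.
have g2 := rel_mul h1 h2 ler01 ler01.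
have g3 : `|(1 + d1) * (1 + d2) * (1 + d3) - 1| <= 7 * u.
  by have := rel_mul g2 h3 _ ler01; lra.
have g4 : `|(1 + d1) * (1 + d2) * (1 + d3) * (1 + d4) - 1| <= 15 * u.
  by have := rel_mul g3 h4 _ ler01; lra.
have g5 : `|(1 + d1) * (1 + d2) * (1 + d3) * (1 + d4) * (1 + d5) - 1| <= 31 * u.
  by have := rel_mul g4 h5 _ ler01; lra.
by have := rel_mul g5 h6; lra.
Qed.

Lemma runs_axpy (k M : nat) (s : state R) (Q : state R -> Prop) :
  ctx n k M s -> ireg s 8 = 0%N ->
  (forall s', ctx n k M s' -> ireg s' 7 = ireg s 7 -> ireg s' 16 = ireg s 16 ->
     freg s' 2 = freg s 2 -> freg s' 3 = freg s 3 -> ncalls s' = ncalls s ->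
     (time s' <= time s + 12 * n + 1)%N ->
     (forall l, (l < n)%N ->
        `|fheap s' l - (fheap s l - fheap s (n + n + l))| <=
           u * `|fheap s l - fheap s (n + n + l)| /\
        `|fheap s' (n + l) - (fheap s (n + l) + freg s 2 * fheap s l)| <=
           u * `|fheap s (n + l)| + 3 * u * `|freg s 2 * fheap s l|) ->
     Q s') ->
  runs solver delta axpy s Q.
Proof.
move=> cs i0 HQ.
pose I (i : nat) (s' : state R) := ctx n k M s' /\ [/\
  [/\ ireg s' 8 = i, ireg s' 7 = ireg s 7 & ireg s' 16 = ireg s 16],
  [/\ freg s' 2 = freg s 2, freg s' 3 = freg s 3 & ncalls s' = ncalls s],
  (time s' <= time s + 12 * i)%N,
  (forall l, (l < n)%N -> fheap s' (n + n + l) = fheap s (n + n + l) /\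
     ((i <= l)%N -> fheap s' l = fheap s l /\ fheap s' (n + l) = fheap s (n + l))) &
  forall l, (l < i)%N -> (l < n)%N ->
        `|fheap s' l - (fheap s l - fheap s (n + n + l))| <=
           u * `|fheap s l - fheap s (n + n + l)| /\
        `|fheap s' (n + l) - (fheap s (n + l) + freg s 2 * fheap s l)| <=
           u * `|fheap s (n + l)| + 3 * u * `|freg s 2 * fheap s l|].
apply: (@runs_while _ _ _ _ _ _ n I _ _ _ _ 0%N) => //.
- move=> i [ir ih fr fh tm nc] iln; rewrite /I /ctx /=.
  move=> [[c0 c1 c2 c6 [c9 c11]] [[i8 i7 i16] [f2 f3 cn] tm1 hr hd]].
  have [hw hvy] := hr _ iln; have [hv hy] := hvy (leqnn i).
  split; first by rewrite i8 c0.
  rewrite /tick /=.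
  apply: runs_fload => v1 E1; rewrite i8 hv in E1.
  apply: runs_iadd => a1 A1; rewrite c0 i8 in A1.
  apply: runs_fload => v2 E2; rewrite /upd /= A1 hy in E2.
  apply: runs_iadd => a2 A2; rewrite /upd /= c11 i8 in A2.
  apply: runs_fload => v3 E3; rewrite /upd /= A2 hw in E3.
  apply: runs_fmul => v4 E4; rewrite /upd /= f2 E1 in E4.
  apply: runs_fadd => v5 E5; rewrite /upd /= E2 E4 in E5.
  apply: runs_fstore => b1 v6 B1 E6; rewrite /upd /= A1 in B1; rewrite /upd /= E5 in E6.
  apply: runs_fsub => v7 E7; rewrite /upd /= E1 E3 in E7.
  apply: runs_fstore => b2 v8 B2 E8; rewrite /upd /= i8 in B2; rewrite /upd /= E7 in E8.
  apply: runs_iadd => a3 A3; rewrite /upd /= i8 c2 addn1 in A3.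
  apply: runs_nil; rewrite /upd /= B1 B2 E6 E8 A3.
  split=> //; split=> //.
  - by move: tm1; clear; lia.
  - move=> l ln; have [hw' hvy'] := hr _ ln.
    rewrite (_ : (n + n + l == i)%N = false); last by move: iln; clear; lia.
    rewrite (_ : (n + n + l == n + i)%N = false); last by move: iln; clear; lia.
    split=> // il; have [-> ->] := hvy' (ltnW il).
    rewrite (_ : (l == i)%N = false); last by move: il; clear; lia.
    rewrite (_ : (l == n + i)%N = false); last by move: ln; clear; lia.
    rewrite (_ : (n + l == i)%N = false); last by move: iln; clear; lia.
    by rewrite (_ : (n + l == n + i)%N = false); last by move: il; clear; lia.
  - move=> l li ln.
    rewrite (_ : (l == n + i)%N = false); last by move: ln; clear; lia.
    rewrite (_ : (n + l == i)%N = false); last by move: iln; clear; lia.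
    rewrite eqn_add2l; have [->|/eqP li'] := eqVneq l i.
      by split; [exact: rnd_err | exact: rnd_err2].
    by apply: hd => //; move: li li'; clear; lia.
- move=> s1 [cs1 [[i8 i7 i16] [f2 f3 cn] tm1 hr hd]]; split.
    by rewrite /= i8; case: cs1 => -> _ _ _ _; rewrite ltnn.
  apply: HQ => //=; first by rewrite addn1.
  by move=> l ln; exact: hd.
- split=> //; split=> //.
  by rewrite muln0 addn0.
Qed.

Lemma runs_coef1 (k M : nat) (s : state R) : ctx n k M s ->
  runs solver delta
    (block [:: IAdd 13 7 7; ISub 14 13 6; ISub 15 6 13; FOfNat 4 14;
               FOfNat 5 15; FArith Defs.Sub 4 4 5; FArith Mul 4 4 2]) s
  (fun s' => ctx n k M s' /\ [/\
  [/\ ireg s' 7 = ireg s 7, ireg s' 16 = ireg s 16 & freg s' 2 = freg s 2],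
  [/\ freg s' 3 = freg s 3, ncalls s' = ncalls s & fheap s' = fheap s],
  time s' = (time s + 7)%N &
  exists d1 d2 d3 d4, freg s' 4 =
    (1 + delta d4) * ((1 + delta d3) * (
       (1 + delta d1) * (2 * ireg s 7 - M)%:R -
       (1 + delta d2) * (M - 2 * ireg s 7)%:R) * freg s 2)]).
Proof.
case: s => ir ih fr fh tm nc; rewrite /ctx /= => -[c0 c1 c2 c6 [c9 c11]].
apply: runs_iadd => a1 A1.
apply: runs_isub => a2 A2; rewrite /upd /= c6 A1 in A2.
apply: runs_isub => a3 A3; rewrite /upd /= c6 A1 in A3.
apply: runs_fofnat => v1 E1; rewrite /upd /= A2 in E1.
apply: runs_fofnat => v2 E2; rewrite /upd /= A3 in E2.
apply: runs_fsub => v3 E3; rewrite /upd /= E1 E2 in E3.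
apply: runs_fmul => v4 E4; rewrite /upd /= E3 in E4.
apply: runs_nil; rewrite /upd /=; split=> //; split=> //; first by clear; lia.
by rewrite E4 mul2n -addnn; do 4!eexists.
Qed.

Lemma runs_coef2 (k M : nat) (s : state R) : ctx n k M s ->
  runs solver delta
    (block [:: FOfNat 5 16; FArith Mul 5 5 3; FArith Defs.Sub 4 4 5;
               FMove 3 2; IAdd 7 7 2]) s
  (fun s' => ctx n k M s' /\ [/\
  [/\ ireg s' 7 = (ireg s 7).+1, ireg s' 16 = ireg s 16 & freg s' 3 = freg s 2],
  ncalls s' = ncalls s /\ fheap s' = fheap s,
  time s' = (time s + 5)%N &
  exists d1 d2 d3, freg s' 4 =
    (1 + delta d3) * (freg s 4 -
      (1 + delta d2) * ((1 + delta d1) * (ireg s 16)%:R * freg s 3))]).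
Proof.
case: s => ir ih fr fh tm nc; rewrite /ctx /= => -[c0 c1 c2 c6 [c9 c11]].
apply: runs_fofnat => v1 E1.
apply: runs_fmul => v2 E2; rewrite /upd /= E1 in E2.
apply: runs_fsub => v3 E3; rewrite /upd /= E2 in E3.
apply: runs_fmove => v4 E4; rewrite /upd /= in E4.
apply: runs_iadd => a1 A1; rewrite c2 addn1 in A1.
apply: runs_nil; rewrite /upd /= A1 E4; split=> //; split=> //; first by clear; lia.
by rewrite E3; do 3!eexists.
Qed.

Lemma runs_coef3 (k M : nat) (s : state R) : ctx n k M s -> (0 < ireg s 7)%N ->
  runs solver delta
    (block [:: FOfNat 5 7; FArith Div 2 4 5; IAdd 16 16 2]) s
  (fun s' => ctx n k M s' /\ [/\
  [/\ ireg s' 7 = ireg s 7, ireg s' 16 = (ireg s 16).+1 & freg s' 3 = freg s 3],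
  ncalls s' = ncalls s /\ fheap s' = fheap s,
  time s' = (time s + 3)%N &
  exists d1 d2, freg s' 2 =
    (1 + delta d2) * (freg s 4 / ((1 + delta d1) * (ireg s 7)%:R))]).
Proof.
have d0 t : 1 + delta t != 0.
  have := delta_le t; rewrite ler_norml => /andP[h _].
  by rewrite gt_eqF //; move: u_le h; lra.
case: s => ir ih fr fh tm nc; rewrite /ctx /= => -[c0 c1 c2 c6 [c9 c11]] j0.
apply: runs_fofnat => v1 E1.
apply: runs_fdiv => [|v2 E2].
  by rewrite /upd /= E1 mulf_eq0 negb_or d0 pnatr_eq0 -lt0n.
rewrite /upd /= E1 in E2.
apply: runs_iadd => a1 A1; rewrite c2 addn1 in A1.
apply: runs_nil; rewrite /upd /= A1; split=> //; split=> //; first by clear; lia.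
by rewrite E2; do 2!eexists.
Qed.

(** Collects the rounding factors of a computed coefficient into one multiplier for each term of the
    recurrence. *)
Lemma coef_algebra (e1 e2 e3 e4 e5 e6 e7 e8 e9 x y z b c c0 : R) :
  x != 0 -> e8 != 0 ->
  x * (e9 * (e7 * (e4 * (e3 * (e1 * y - e2 * z) * c) - e6 * (e5 * b * c0)) /
    (e8 * x))) =
  e4 * e3 * (e1 * y - e2 * z) * e7 * e9 / e8 * c -
  e6 * e5 * e7 * e9 / e8 * (b * c0).
Proof. by move=> x0 e0; field; rewrite x0 e0. Qed.

(** Backward error: the computed coefficient satisfies the recurrence exactly, with its two terms
    multiplied by [a] and [b] close to 1. Cancellation between the terms is thus harmless at this
    stage. *)
Lemma runs_next_coef (k M : nat) (s : state R) (Q : state R -> Prop) :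
  ctx n k M s ->
  (forall s', ctx n k M s' -> ireg s' 7 = (ireg s 7).+1 ->
     ireg s' 16 = (ireg s 16).+1 ->
     freg s' 3 = freg s 2 -> ncalls s' = ncalls s -> fheap s' = fheap s ->
     time s' = (time s + 15)%N ->
     (exists a b : R, [/\ `|a - 1| <= 95 * u, `|b - 1| <= 95 * u &
       (ireg s 7).+1%:R * freg s' 2 =
         a * ((2 * (ireg s 7)%:R - M%:R) * freg s 2) -
         b * ((ireg s 16)%:R * freg s 3)]) ->
     Q s') ->
  runs solver delta next_coef s Q.
Proof.
move=> cs HQ.
have d0 t : 1 + delta t != 0.
  have := delta_le t; rewrite ler_norml => /andP[h _].
  by rewrite gt_eqF //; move: u_le h; lra.
apply: runs_seq; apply: (runs_imp (runs_coef1 cs)).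
move=> s1 [cs1 [[i7 i16 f2] [f3 cn hp] tm1 [d1 [d2 [d3 [d4 f4]]]]]].
apply: runs_seq; apply: (runs_imp (runs_coef2 cs1)).
move=> s2 [cs2 [[i7' i16' f3'] [cn' hp'] tm2 [d5 [d6 [d7 f4']]]]].
have i70 : (0 < ireg s2 7)%N by rewrite i7'.
apply: (runs_imp (runs_coef3 cs2 i70)).
move=> s' [cs' [[j7 j16 g3] [cn'' hp''] tm3 [d8 [d9 g2]]]].
apply: HQ => //; rewrite ?j7 ?i7' ?i7 ?j16 ?i16' ?i16 ?g3 ?f3' ?f2 //.
- by rewrite cn'' cn' cn.
- by rewrite hp'' hp' hp.
- by rewrite tm3 tm2 tm1 -!addnA.
have Ea d := rel_prod (delta_le d4) (delta_le d3) (delta_le d) (delta_le d7)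
  (delta_le d9) (delta_le d8).
(* The second term undergoes one rounding fewer; a zero error fills the vacant slot of
   [rel_prod]. *)
have z0 : `|0 : R| <= u by rewrite normr0; exact: u0.
have := rel_prod (delta_le d6) (delta_le d5) z0 (delta_le d7)
  (delta_le d9) (delta_le d8).
rewrite addr0 mulr1 => bu.
(* Only the nonzero one of the two truncated differences contributes its rounding factor, so [a] is
   a plain product. *)
have [a au aE] : exists2 a, `|a - 1| <= 95 * u &
   (1 + delta d4) * (1 + delta d3) * ((1 + delta d1) * (2 * ireg s 7 - M)%:R -
       (1 + delta d2) * (M - 2 * ireg s 7)%:R) * (1 + delta d7) *
   (1 + delta d9) / (1 + delta d8) = a * (2 * (ireg s 7)%:R - M%:R).
  case: (leqP (2 * ireg s 7) M) => hM.
    eexists; first exact: (Ea d2).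
    have -> : (2 * ireg s 7 - M = 0)%N by move: hM; clear; lia.
    by rewrite natrB // natrM; ring.
  eexists; first exact: (Ea d1).
  have -> : (M - 2 * ireg s 7 = 0)%N by move: hM; clear; lia.
  by rewrite natrB ?natrM; [ring | exact: ltnW].
exists a; eexists; split; [exact: au | exact: bu |].
rewrite [a * (_ * _)]mulrA -aE g2 f4' f4 i7' i7 i16 f3.
by apply: coef_algebra; rewrite ?pnatr_eq0.
Qed.

Lemma runs_taylor (k M : nat) (s : state R) (Q : state R -> Prop) :
  ctx n k M s ->
  (forall s', ctx n k M s' -> ireg s' 7 = (ireg s 7).+1 ->
     ireg s' 16 = (ireg s 16).+1 ->
     freg s' 3 = freg s 2 -> ncalls s' = (ncalls s).+1 ->
     (time s' <= time s + 12 * n + 17)%N ->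
     (exists a b : R, [/\ `|a - 1| <= 95 * u, `|b - 1| <= 95 * u &
       (ireg s 7).+1%:R * freg s' 2 =
         a * ((2 * (ireg s 7)%:R - M%:R) * freg s 2) -
         b * ((ireg s 16)%:R * freg s 3)]) ->
     (forall (v v' y y' w : 'cV[R]_n), v = read_vec n (fheap s) 0 ->
       y = read_vec n (fheap s) n -> w = solver (ncalls s) v ->
       v' = read_vec n (fheap s') 0 -> y' = read_vec n (fheap s') n ->
       forall i, `|v' i 0 - (v i 0 - w i 0)| <= u * `|v i 0 - w i 0| /\
         `|y' i 0 - (y i 0 + freg s 2 * v i 0)| <=
           u * `|y i 0| + 3 * u * `|freg s 2 * v i 0|) ->
     Q s') ->
  runs solver delta taylor s Q.
Proof.
case: s => ir ih fr fh tm nc cs HQ; apply: runs_seq.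
case: (cs) => c0 c1 c2 c6 [c9 c11].
apply: runs_call => h hE; rewrite /= in c0 c1 c2 c6 c9 c11.
apply: runs_iconst => a0 A0; apply: runs_nil.
apply: runs_seq; apply: (@runs_axpy k M); first by split; rewrite /= /upd /=.
  by rewrite /= /upd /= A0.
move=> s1 cs1; rewrite /= /upd /= => i7 i16 f2 f3 cn tm1 hp.
apply: (runs_next_coef cs1) => s2 cs2 j7 j16 g3 cn2 hp2 tm2 [a [b [au bu gE]]].
apply: HQ.
- exact: cs2.
- by rewrite j7 i7.
- by rewrite j16 i16.
- by rewrite g3 f2.
- by rewrite cn2 cn.
- by move: tm1 tm2; rewrite /=; clear; lia.
- by exists a, b; split=> //; move: gE; rewrite i7 i16 f2 f3.
move=> v v' y y' w vE yE wE v'E y'E i.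
have [] := hp i (ltn_ord i).
have := ltn_ord i; rewrite -hp2 hE c11 c9 => lt_i.
rewrite write_vec_in write_vec_out; last by apply/orP; left; move: lt_i; clear; lia.
rewrite write_vec_out; last by apply/orP; left; move: lt_i; clear; lia.
by rewrite v'E y'E yE wE vE !mxE.
Qed.

End Exec.

(** * Error analysis *)

Lemma expmx_mulS (R : realType) n (S : 'M[R]_n) i (v : 'cV[R]_n) :
  S ^+ i.+1 *m v = S *m (S ^+ i *m v).
Proof. by rewrite exprS; exact: (esym (mulmxA _ _ _)). Qed.

Lemma enorm_dist (R : realType) n (v w z : 'cV[R]_n) :
  enorm (v - z) <= enorm (v - w) + enorm (w - z).
Proof. by apply: le_trans (enormD _ _); rewrite addrA subrK. Qed.

(** The error plus 95 eta |c| is the quantity that propagates. Each term contributes its inherited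
    error, its fresh perturbation, and at most twice that perturbation for the new 95 eta |c1|:
    hence p = 3 and q = 3 * 4, and 3 * 6 + 12 <= 6^2. *)
Lemma lag_rounding (R : realType) (eta : R) (M N j : nat) (a b c c0 c1 : R) :
  0 <= eta -> 191 * eta <= 1 -> (0 < M)%N ->
  (N.-1 + M <= 4 * M + 1)%N -> (j < M)%N ->
  `|a - 1| <= 95 * eta -> `|b - 1| <= 95 * eta ->
  j.+1%:R * c1 =
    a * ((2 * j%:R - M%:R) * c) - b * ((N.-1 + j)%:R * c0) ->
  `|c - lag R M N j| + 95 * eta * `|c| <= 191 * eta * bnd 6 M j ->
  6 * M%:R * (`|c0 - (lag2 R M N j).2| + 95 * eta * `|c0|) <=
    191 * eta * (j%:R * bnd 6 M j) ->
  `|c1 - lag R M N j.+1| + 95 * eta * `|c1| <= 191 * eta * bnd 6 M j.+1.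
Proof.
move=> eta0 eta_le M0 NM jM ha hb hc1 hc hc0.
have k0 : 0 <= 191 * eta by move: eta0; lra.
apply: (@bnd_step _ 3 12 _ _ _ _ _ M j _ _ _ k0 (ltnW jM) M0 _ hc hc0) => //; try lra.
have j0 : 0 <= j.+1%:R :> R by [].
have h1 : j.+1%:R * (c1 - lag R M N j.+1) =
  (2 * j%:R - M%:R) * (c - lag R M N j) - (N.-1 + j)%:R * (c0 - (lag2 R M N j).2)
  + (a - 1) * ((2 * j%:R - M%:R) * c) - (b - 1) * ((N.-1 + j)%:R * c0).
  by rewrite mulrBr hc1 lagS; ring.
have al : `|2 * j%:R - M%:R| <= M%:R :> R by rewrite lag_coef_le // ltnW.
have bl : `|(N.-1 + j)%:R| <= 4 * M%:R :> R.
  by rewrite ger0_norm // -natrM ler_nat; move: NM jM; clear; lia.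
have q (y : R) : j.+1%:R * `|y| = `|j.+1%:R * y| by rewrite normrM (ger0_norm j0).
rewrite mulrDr q [X in _ + X]mulrCA q h1 hc1.
have na : `|a| <= 2.
  have := ler_normD (a - 1) 1; rewrite subrK normr1 => h; move: h ha eta_le eta0; clear; lra.
have nb : `|b| <= 2.
  have := ler_normD (b - 1) 1; rewrite subrK normr1 => h; move: h hb eta_le eta0; clear; lra.
set A := 2 * j%:R - M%:R in al *; set B := (N.-1 + j)%:R in bl *.
have Ac : `|A * c| <= M%:R * `|c| by rewrite normrM ler_wpM2r.
have Bc : `|B * c0| <= 4 * M%:R * `|c0| by rewrite normrM ler_wpM2r.
set e := c - _; set e0 := c0 - _.
have Ae : `|A * e| <= M%:R * `|e| by rewrite normrM ler_wpM2r.
have Be : `|B * e0| <= 4 * M%:R * `|e0| by rewrite normrM ler_wpM2r.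
have t1 : `|(a - 1) * (A * c)| <= 95 * eta * (M%:R * `|c|).
  by rewrite normrM ler_pM.
have t2 : `|(b - 1) * (B * c0)| <= 95 * eta * (4 * M%:R * `|c0|).
  by rewrite normrM ler_pM.
have t3 : `|a * (A * c)| <= 2 * (M%:R * `|c|) by rewrite normrM ler_pM.
have t4 : `|b * (B * c0)| <= 2 * (4 * M%:R * `|c0|) by rewrite normrM ler_pM.
have s1 := ler_normB (A * e - B * e0 + (a - 1) * (A * c)) ((b - 1) * (B * c0)).
have s2 := ler_normD (A * e - B * e0) ((a - 1) * (A * c)).
have s3 := ler_normB (A * e) (B * e0).
have s4 := ler_normB (a * (A * c)) (b * (B * c0)).
have s5 : 95 * eta * `|a * (A * c) - b * (B * c0)| <=
  95 * eta * (2 * (M%:R * `|c|) + 2 * (4 * M%:R * `|c0|)).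
  by rewrite ler_wpM2l ?mulr_ge0 //; move: s4 t3 t4; clear; lra.
have Me : 0 <= M%:R * `|e| by rewrite mulr_ge0.
have Me0 : 0 <= M%:R * `|e0| by rewrite mulr_ge0.
have : 3 * M%:R * (`|e| + 95 * eta * `|c|) =
  3 * (M%:R * `|e|) + 3 * (95 * eta * (M%:R * `|c|)) by ring.
move=> ->.
have -> : 12 * M%:R * (`|e0| + 95 * eta * `|c0|) =
  12 * (M%:R * `|e0|) + 3 * (95 * eta * (4 * M%:R * `|c0|)) by ring.
move: s1 s2 s3 s5 t1 t2 Ae Be Me Me0; clear.
set p1 := 95 * eta * (M%:R * _); set p2 := 95 * eta * (4 * M%:R * _).
have -> : 95 * eta * (2 * (M%:R * `|c|) + 2 * (4 * M%:R * `|c0|)) = 2 * p1 + 2 * p2.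
  by rewrite /p1 /p2; ring.
move: p1 p2 => p1 p2; lra.
Qed.

(** 20 exceeds 6 e, so 20^M dominates the majorants of both the coefficients and their errors; 400
    leaves room for the factor 191. *)
Definition Dbound (R : realType) (M : nat) : R := 400 * 20 ^+ M.

Lemma bnd_le20 (R : realType) (mu : R) (M j : nat) : 1 <= mu <= 6 -> (j <= M)%N ->
  bnd mu M j <= 20 ^+ M.
Proof.
move=> /andP[m1 m6] jM.
have mu0 : 0 <= mu by lra.
apply: (le_trans (bnd_le M j mu0)).
have -> : expR M%:R = expR 1 ^+ M :> R by rewrite -expRM_natl mulr1.
have e3 := expR1_le R.
apply: (@le_trans _ _ (mu ^+ M * expR 1 ^+ M)).
  by rewrite ler_wpM2r ?exprn_ge0 ?expR_ge0 // ler_weXn2l.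
rewrite -exprMn; apply: lerXn2r; rewrite ?nnegrE ?mulr_ge0 ?expR_ge0 //.
apply: (@le_trans _ _ (6 * (256 / 81))); last by lra.
by apply: ler_pM; rewrite ?expR_ge0.
Qed.

Lemma coef_bounds (R : realType) (eta : R) (M N j : nat) (c : R) :
  0 <= eta -> 191 * eta <= 1 -> (0 < M)%N ->
  (N.-1 + M <= 4 * M + 1)%N -> (j <= M)%N ->
  `|c - lag R M N j| + 95 * eta * `|c| <= 191 * eta * bnd 6 M j ->
  [/\ `|c| <= Dbound R M, `|lag R M N j| <= Dbound R M &
      `|c - lag R M N j| <= eta * Dbound R M].
Proof.
move=> eta0 eta_le M0 NM jM h; rewrite /Dbound.
have b6 : bnd 6 M j <= 20 ^+ M :> R by apply: bnd_le20 => //; apply/andP; split; lra.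
have [l1 _] := @lag_bnd R M N j M0 NM jM.
have b8 : bnd (8 / 3) M j <= 20 ^+ M :> R by apply: bnd_le20 => //; apply/andP; split; lra.
have p0 : 0 <= 20 ^+ M :> R by rewrite exprn_ge0.
have ec : 0 <= 95 * eta * `|c| by rewrite !mulr_ge0.
have t1 : 191 * eta * bnd 6 M j <= 191 * eta * 20 ^+ M.
  by apply: ler_wpM2l b6; move: eta0; clear; lra.
have t2 : 191 * eta * 20 ^+ M <= 1 * 20 ^+ M by rewrite ler_wpM2r.
have t3 : 0 <= eta * 20 ^+ M by rewrite mulr_ge0.
have := ler_normD (c - lag R M N j) (lag R M N j); rewrite subrK => t4.
by split; lra.
Qed.

Lemma enorm_mono2 (R : realType) n (a b : R) (e v w : 'cV[R]_n) : 0 <= a -> 0 <= b ->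
  (forall i, `|e i 0| <= a * `|v i 0| + b * `|w i 0|) ->
  enorm e <= a * enorm v + b * enorm w.
Proof.
move=> a0 b0 h; pose ab (z : 'cV[R]_n) := \col_i `|z i 0|.
have abE z : enorm (ab z) = enorm z.
  rewrite /enorm; congr Num.sqrt; apply: eq_bigr => i _.
  by rewrite mxE real_normK // num_real.
rewrite -(abE v) -(abE w) -{1}(ger0_norm a0) -{1}(ger0_norm b0) -!enormZ.
apply: le_trans (enormD _ _); rewrite -[leRHS]mul1r.
apply: enorm_mono => // i; rewrite mul1r !mxE [leRHS]ger0_norm //.
by rewrite addr_ge0 // mulr_ge0.
Qed.

(** In units of eta T the new error is 2 from the subtraction, 1 from the solver and 3 inherited,
    since 1 - S is a contraction. Letting T grow by 4 allows 12. *)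
Lemma difference_step (R : realType) n (S : 'M[R]_n) (eta T : R)
    (p v w v' : 'cV[R]_n) :
  0 <= eta <= 1 -> (forall v, enorm ((1%:M - S) *m v) <= enorm v) ->
  enorm (S *m v - w) <= eta * enorm v ->
  (forall i, `|v' i 0 - (v i 0 - w i 0)| <= eta * `|v i 0 - w i 0|) ->
  enorm (v - p) <= 3 * eta * T -> enorm v <= T ->
  enorm (v' - (1%:M - S) *m p) <= 3 * eta * (4 * T) /\ enorm v' <= 4 * T.
Proof.
move=> /andP[eta0 eta1] subS_le hw hv' hp hT.
have e1 : enorm (v' - (v - w)) <= eta * enorm (v - w).
  by apply: enorm_mono => // i; have := hv' i; rewrite !mxE.
have e2 : enorm (v - w - (1%:M - S) *m v) <= eta * enorm v.
  by rewrite mulmxBl mul1mx opprB addrC addrA addrNK.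
have e3 : enorm (v - w) <= 2 * enorm v.
  have := enormD (v - w - (1%:M - S) *m v) ((1%:M - S) *m v); rewrite subrK.
  have := subS_le v; have := enorm_ge0 v.
  have : eta * enorm v <= 1 * enorm v by rewrite ler_wpM2r // enorm_ge0.
  by move: e2; clear; lra.
have e4 : eta * enorm (v - w) <= eta * (2 * enorm v) by rewrite ler_wpM2l.
have e5 : eta * enorm v <= eta * T by rewrite ler_wpM2l.
have T0 : 0 <= T := le_trans (enorm_ge0 v) hT.
have e6 : eta * T <= 1 * T by rewrite ler_wpM2r.
have e7 : 0 <= eta * T by rewrite mulr_ge0.
split.
  have e8 : enorm ((1%:M - S) *m v - (1%:M - S) *m p) <= 3 * eta * T.
    by rewrite -mulmxBr; apply: le_trans (subS_le _) hp.
  have := enorm_dist v' (v - w) ((1%:M - S) *m p).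
  have := enorm_dist (v - w) ((1%:M - S) *m v) ((1%:M - S) *m p).
  by move: e1 e2 e4 e5 e7 e8; clear; lra.
have := enormD (v' - (v - w)) (v - w); rewrite subrK.
by move: e1 e3 e4 e5 e6 hT; clear; lra.
Qed.

(** In units of eta D T: 4 + 3 from rounding, 1 + 3 from the errors of coefficient and vector, 4
    inherited; the total 15 fits into 16. *)
Lemma axpy_step (R : realType) n (eta D T c l : R) (p q v y y' : 'cV[R]_n) :
  0 <= eta <= 1 -> 0 <= D ->
  `|c| <= D -> `|l| <= D -> `|c - l| <= eta * D ->
  (forall i, `|y' i 0 - (y i 0 + c * v i 0)| <=
     eta * `|y i 0| + 3 * eta * `|c * v i 0|) ->
  enorm (v - p) <= 3 * eta * T -> enorm v <= T ->
  enorm (y - q) <= 4 * eta * (D * T) -> enorm y <= D * (4 * T) ->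
  enorm (y' - (q + l *: p)) <= 4 * eta * (D * (4 * T)) /\
  enorm y' <= D * (4 * (4 * T)).
Proof.
move=> /andP[eta0 eta1] D0 hc hl hcl hy' hp hT hq hy.
have T0 : 0 <= T := le_trans (enorm_ge0 v) hT.
have cv : `|c| * enorm v <= D * T by apply: ler_pM => //; exact: enorm_ge0.
have e1 : enorm (y' - (y + c *: v)) <= eta * enorm y + 3 * eta * (`|c| * enorm v).
  rewrite -enormZ; apply: enorm_mono2 => //; first by rewrite mulr_ge0.
  by move=> i; have := hy' i; rewrite !mxE.
have e2 : eta * enorm y <= eta * (D * (4 * T)) by rewrite ler_wpM2l.
have e3 : eta * (`|c| * enorm v) <= eta * (D * T) by rewrite ler_wpM2l.
have DT0 : 0 <= D * T by rewrite mulr_ge0.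
have e4 : eta * (D * T) <= 1 * (D * T) by rewrite ler_wpM2r.
have e7 : 0 <= eta * (D * T) by rewrite mulr_ge0.
split.
  have cl : `|c - l| * enorm v <= eta * D * T.
    by apply: ler_pM => //; exact: enorm_ge0.
  have lp : `|l| * enorm (v - p) <= D * (3 * eta * T).
    by apply: ler_pM => //; exact: enorm_ge0.
  have e5 : enorm (c *: v - l *: p) <= eta * D * T + D * (3 * eta * T).
    have -> : c *: v - l *: p = (c - l) *: v + l *: (v - p).
      by rewrite scalerBl scalerBr addrA subrK.
    by apply: le_trans (enormD _ _) _; rewrite !enormZ lerD.
  have e6 : enorm (y + c *: v - (q + l *: p)) <=
      enorm (y - q) + enorm (c *: v - l *: p).
    by rewrite opprD addrACA; exact: enormD.
  have := enorm_dist y' (y + c *: v) (q + l *: p).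
  have -> : 4 * eta * (D * (4 * T)) = 16 * (eta * (D * T)) by ring.
  move: e1 e2 e3 e5 e6 e7 hq; rewrite -!(mulrA _ eta).
  have -> : eta * (D * (4 * T)) = 4 * (eta * (D * T)) by ring.
  have -> : D * (3 * (eta * T)) = 3 * (eta * (D * T)) by ring.
  by clear; lra.
have := enormD (y' - (y + c *: v)) (y + c *: v); rewrite subrK.
have := enormD y (c *: v); rewrite enormZ.
move: e1 e2 e3 e4 cv hy; rewrite -!(mulrA _ eta).
have -> : D * (4 * (4 * T)) = 16 * (D * T) by ring.
have -> : D * (4 * T) = 4 * (D * T) by ring.
by move: DT0; clear; lra.
Qed.

(** [S] is a contraction, so inherited errors are not amplified; [a] carries the error of the first
    loop through unchanged. *)
Lemma power_step (R : realType) n (S : 'M[R]_n) (eta a T : R)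
    (q y y' : 'cV[R]_n) :
  0 <= eta <= 1 -> (forall v, enorm (S *m v) <= enorm v) ->
  enorm (S *m y - y') <= eta * enorm y ->
  enorm (y - q) <= a + eta * T -> enorm y <= T ->
  enorm (y' - S *m q) <= a + eta * (2 * T) /\ enorm y' <= 2 * T.
Proof.
move=> /andP[eta0 eta1] S_le hy' hq hT.
have e1 : eta * enorm y <= eta * T by rewrite ler_wpM2l.
have e2 : eta * enorm y <= 1 * enorm y by rewrite ler_wpM2r // enorm_ge0.
split.
  have e3 : enorm (S *m y - S *m q) <= a + eta * T.
    by rewrite -mulmxBr; apply: le_trans (S_le _) hq.
  have := enorm_dist y' (S *m y) (S *m q).
  by rewrite -[enorm (y' - S *m y)]enormN opprB; move: e1 e3 hy'; clear; lra.
have := enormB (S *m y) (S *m y - y'); rewrite opprB addrC subrK.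
by have := S_le y; move: e2 hT hy'; clear; lra.
Qed.

Definition approx (R : realType) n (S : 'M[R]_n) (x : 'cV[R]_n) (M N j : nat) :
    'cV[R]_n :=
  \sum_(i < j) lag R M N i *: ((1%:M - S) ^+ i *m x).

Lemma enorm0 (R : realType) n : enorm (0 : 'cV[R]_n) = 0.
Proof. by rewrite -(scale0r 0) enormZ normr0 mul0r. Qed.

Lemma Dbound_ge0 (R : realType) M : 0 <= Dbound R M.
Proof. by apply: mulr_ge0; [exact: ler0n | exact: exprn_ge0 (ler0n _ 20)]. Qed.

(** * Loop invariants and the complete run *)

Section Run.
Variables (R : realType) (n : nat) (S : 'M[R]_n) (x : 'cV[R]_n).
Variables (solver : nat -> 'cV[R]_n -> 'cV[R]_n) (delta : nat -> R) (eta : R).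
Hypotheses (eta0 : 0 <= eta) (eta_le : 191 * eta <= 1).
Hypothesis delta_le : forall t, `|delta t| <= eta.
Hypothesis S_le : forall v, enorm (S *m v) <= enorm v.
Hypothesis subS_le : forall v, enorm ((1%:M - S) *m v) <= enorm v.
Hypothesis solver_le :
  forall j w, enorm (S *m w - solver j w) <= eta * enorm w.

Let eta1 : 0 <= eta <= 1.
Proof. by apply/andP; split => //; move: eta_le eta0; lra. Qed.

Let eta2 : eta <= 1 / 2.
Proof. by move: eta_le eta0; lra. Qed.

Definition taylor_inv (k M N T0 j : nat) (s : state R) : Prop :=
  [/\ ctx n k M s,
    [/\ ireg s 7 = j, ireg s 16 = (N.-1 + j)%N, ncalls s = j &
        (time s <= T0 + j * (12 * n + 18))%N],
    `|freg s 2 - lag R M N j| + 95 * eta * `|freg s 2| <=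
        191 * eta * bnd 6 M j /\
    6 * M%:R * (`|freg s 3 - (lag2 R M N j).2| + 95 * eta * `|freg s 3|) <=
      191 * eta * (j%:R * bnd 6 M j),
    enorm (read_vec n (fheap s) 0 - (1%:M - S) ^+ j *m x) <=
        3 * eta * (4 ^+ j * enorm x) /\
    enorm (read_vec n (fheap s) 0) <= 4 ^+ j * enorm x &
    enorm (read_vec n (fheap s) n - approx S x M N j) <=
        4 * eta * (Dbound R M * (4 ^+ j * enorm x)) /\
    enorm (read_vec n (fheap s) n) <= Dbound R M * (4 * (4 ^+ j * enorm x))].

Lemma taylor_inv_step (k M N T0 j : nat) (s : state R) :
  (0 < M)%N -> (N.-1 + M <= 4 * M + 1)%N -> (j < M)%N ->
  taylor_inv k M N T0 j s ->
  eval_test (ILt 7 6) s /\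
  runs solver delta taylor (tick s) (taylor_inv k M N T0 j.+1).
Proof.
move=> M0 NM jM [cs [i7 i16 cn tm] [hc hc0] [hp hv] [hq hy]].
case: (cs) => c0 c1 c2 c6 [c9 c11].
split; first by rewrite /= i7 c6.
apply: (@runs_taylor _ _ _ _ _ eta2 delta_le k M); first exact: cs.
move=> s' cs' i7' i16' f3' cn' tm' [a [b [ha hb hc']]] hvec.
rewrite /= in i7' i16' f3' cn' tm' hc' hvec.
have jM' := ltnW jM.
have [cD lD clD] := coef_bounds eta0 eta_le M0 NM jM' hc.
have D0 : 0 <= Dbound R M by apply: le_trans cD.
set v := read_vec n (fheap s) 0 in hp hv hvec.
set y := read_vec n (fheap s) n in hq hy hvec.
have {}hvec := hvec v _ y _ _ erefl erefl erefl erefl erefl.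
have [hp' hv'] := difference_step eta1 subS_le (solver_le (ncalls s) v)
  (fun i => (hvec i).1) hp hv.
have [hq' hy'] := axpy_step eta1 D0 cD lD clD (fun i => (hvec i).2) hp hv hq hy.
have E4 : 4 ^+ j.+1 * enorm x = 4 * (4 ^+ j * enorm x).
  by rewrite exprS mulrA.
split; rewrite ?E4 //.
- split; [by rewrite i7' i7 | by rewrite i16' i16 addnS | by rewrite cn' cn |].
  by move: tm tm'; clear; lia.
- rewrite i7 i16 in hc'; split.
    exact: (lag_rounding eta0 eta_le M0 NM jM ha hb hc' hc hc0).
  rewrite f3' lag2S; apply: bnd_prev => //.
- by split=> //; rewrite expmx_mulS.
- by split=> //; rewrite /approx big_ord_recr.
Qed.

Lemma approx_loop (k M N T0 : nat) (s : state R) Q :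
  (0 < M)%N -> (N.-1 + M <= 4 * M + 1)%N -> taylor_inv k M N T0 0 s ->
  (forall s', taylor_inv k M N T0 M s' -> Q (tick s')) ->
  runs solver delta (While (ILt 7 6) taylor) s Q.
Proof.
move=> M0 NM hs hQ.
apply: (@runs_while _ _ _ _ _ _ M (taylor_inv k M N T0) s _ _ _ 0%N) => //.
- by move=> i s1 iM; exact: taylor_inv_step.
- move=> s1 h1; split; last exact: hQ.
  by case: h1 => -[_ _ _ c6 _] [i7 _ _ _] _ _ _; rewrite /= i7 c6 ltnn.
Qed.

Lemma power_loop (k M N T0 : nat) (s : state R) (q : 'cV[R]_n) (a T : R)
    (Q : state R -> Prop) :
  (0 < N)%N -> k = (M + N)%N ->
  ireg s 1 = k -> ireg s 2 = 1%N -> ireg s 9 = 0%N ->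
  ireg s 7 = M -> ireg s 17 = n -> ncalls s = M -> (time s <= T0)%N ->
  enorm (read_vec n (fheap s) n - q) <= a + eta * T ->
  enorm (read_vec n (fheap s) n) <= T ->
  (forall s', ncalls s' = k -> (time s' <= T0 + 3 * N + 1)%N ->
    enorm (S ^+ N *m q - output n s') <= a + eta * (2 ^+ N * T) ->
    Q s') ->
  runs solver delta power s Q.
Proof.
move=> N0 kE r1 r2 r9 r7 r17 cn tm hq hT HQ.
(* The current vector is at n before the first call and at 0 afterwards; as 0 < N, it ends where
   [output] reads. *)
pose I (i : nat) (s' : state R) :=
  [/\ ireg s' 1 = k, ireg s' 2 = 1%N & ireg s' 9 = 0%N] /\ [/\
    [/\ ireg s' 7 = (M + i)%N & ireg s' 17 = if i == 0%N then n else 0%N],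
    ncalls s' = (M + i)%N, (time s' <= T0 + 3 * i)%N,
    enorm (read_vec n (fheap s') (ireg s' 17) - S ^+ i *m q) <=
      a + eta * (2 ^+ i * T) &
    enorm (read_vec n (fheap s') (ireg s' 17)) <= 2 ^+ i * T].
apply: (@runs_while _ _ _ _ _ _ N I _ _ _ _ 0%N) => //.
- move=> i [ir ih fr fh tm' nc] iN; rewrite /I /=.
  move=> [[c1 c2 c9] [[i7 i17] ci ti hi hi']].
  split; first by rewrite i7 c1 kE ltn_add2l.
  rewrite /tick /=.
  apply: runs_call => h hE; rewrite c9 in hE.
  apply: runs_iconst => a1 A1.
  apply: runs_iadd => a2 A2; rewrite /upd /= i7 c2 addn1 in A2.
  apply: runs_nil; rewrite /upd /= A1 A2 hE read_write_vec.
  have [e1 e2] := power_step eta1 S_le (solver_le nc _) hi hi'.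
  split=> //; split=> //.
  + by rewrite addnS.
  + by rewrite ci addnS.
  + by move: ti; clear; lia.
  + by rewrite expmx_mulS exprS -mulrA.
  + by rewrite exprS -mulrA.
- move=> s1 [[c1 c2 c9] [[i7 i17] ci ti hi hi']].
  split; first by rewrite /= i7 c1 kE ltnn.
  rewrite (gtn_eqF N0) in i17; apply: HQ => /=.
  + by rewrite ci kE.
  + by move: ti; clear; lia.
  + by rewrite i17 in hi; rewrite -enormN opprB.
- split=> //; split; rewrite ?addn0 ?muln0 ?addn0 ?r17 //.
    by rewrite expr0 [1 *m _]mul1mx mul1r.
  by rewrite expr0 mul1r.
Qed.

Lemma runs_exp_prog (k M N : nat) (eps eps1 : R) (Q : state R -> Prop) :
  (3 <= k)%N ->
  M = ((k - 3) %/ 4).+1 -> N = (k - M)%N ->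
  (forall s', ncalls s' = k -> (time s' <= 12 * n * k + 24 * k + 13)%N ->
    enorm (S ^+ N *m approx S x M N M - output n s') <=
      4 * eta * (Dbound R M * (4 ^+ M * enorm x)) +
      eta * (2 ^+ N * (Dbound R M * (4 * (4 ^+ M * enorm x)))) ->
    Q s') ->
  runs solver delta exp_prog (init k eps eps1 x) Q.
Proof.
move=> k3 -> -> {M N}; set M := (_ %/ _).+1; set N := (k - M)%N => HQ.
have dk := divn_eq (k - 3) 4.
have rk : ((k - 3) %% 4 < 4)%N by rewrite ltn_mod.
have [ME kE] : (k - 3 = 4 * M - 4 + (k - 3) %% 4 /\ k = M + N)%N.
  by rewrite /N /M; move: dk rk k3; move: ((k - 3) %/ 4)%N ((k - 3) %% 4)%N => p r; lia.
have M0 : (0 < M)%N by [].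
have N0 : (0 < N)%N by move: ME kE rk k3 M0; move: (M) (N) ((k - 3) %% 4)%N; clear; lia.
have NM : (N.-1 + M <= 4 * M + 1)%N.
  by move: ME kE rk k3 M0; move: (M) (N) ((k - 3) %% 4)%N; clear; lia.
apply: runs_seq; rewrite /setup /init.
apply: runs_iconst => a1 A1; apply: runs_iconst => a2 A2.
apply: runs_iconst => a3 A3.
apply: runs_iadd => a4 A4; rewrite /upd /= addn0 in A4.
apply: runs_iconst => a5 A5.
apply: runs_iadd => a6 A6; rewrite /upd /= in A6.
apply: runs_fofnat => v1 E1; rewrite /upd /= A1 mulr1 in E1.
apply: runs_nil; apply: runs_seq.
pose I (i : nat) (s' : state R) := [/\
  [/\ ireg s' 0 = n, ireg s' 1 = k, ireg s' 2 = 1%N & ireg s' 3 = 4%N],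
  [/\ ireg s' 4 = 6%N, ireg s' 5 = (k - 4 * i)%N, ireg s' 6 = i.+1,
      ireg s' 7 = 0%N & ireg s' 9 = 0%N /\ ireg s' 11 = (n + n)%N],
  [/\ freg s' 2 = v1, freg s' 3 = 0 & fheap s' = write_vec (fun=> 0) 0 x] &
  ncalls s' = 0%N /\ (time s' <= 7 + 3 * i)%N].
apply: (@runs_while _ _ _ _ _ _ M.-1 I _ _ _ _ 0%N) => //; last first.
- by rewrite /I /= /upd /= A1 A2 A3 A4 A5 A6 subn0.
- move=> [ir ih fr fh tm nc] [/= [c0 c1 c2 c3] [c4 c5 c6 c7 [c9 c11]] [f2 f3 hE] [cn ti]].
  split.
    by rewrite c4 c5; move: ME kE rk k3 M0; move: (M) (N) ((k - 3) %% 4)%N; clear; lia.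
  rewrite /tick /=; apply: runs_seq.
  apply: runs_isub => b1 B1; rewrite c1 c6 in B1.
  apply: runs_isub => b2 B2; rewrite /upd /= B1 c2 in B2.
  apply: runs_nil; apply: runs_seq.
  apply: (@approx_loop k M N (3 * k + 10) _ _ M0 NM).
    split.
    + by split; rewrite /= /upd /= ?c6.
    + split; rewrite /= /upd //=.
        rewrite B2 addn0 /N; clear; lia.
      by rewrite mul0n addn0; move: ti ME kE rk k3 M0; move: (M) (N) ((k - 3) %% 4)%N; clear; lia.
    + rewrite /= f2 f3 subrr normr0 !mulr0 addr0 mulr0 mul0r mulr0; split=> //.
      (* Origin of 191: the initial coefficient is 1 + d with |d| <= eta, and eta + 95 eta * 2 = 191
         eta. *)
      rewrite /bnd expr0 fact0 divr1 mulr1 E1 /lag /= addrAC subrr add0r.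
      set d := delta _; have hd : `|d| <= eta := delta_le _.
      have h1 := ler_normD 1 d; rewrite normr1 in h1.
      have h2 : 95 * eta * `|1 + d| <= 95 * eta * 2.
        by apply: ler_wpM2l; move: eta0 eta_le hd h1; lra.
      by move: hd h2; lra.
    + rewrite /= hE read_write_vec expr0 [1 *m _]mul1mx subrr mul1r; split=> //.
      by rewrite enorm0 !mulr_ge0 ?enorm_ge0.
    + rewrite /= hE.
      have -> : read_vec n (write_vec (fun=> 0) 0 x) n = 0 :> 'cV[R]_n.
        apply/colP => i; rewrite !mxE write_vec_out //.
        by apply/orP; right; rewrite add0n leq_addr.
      rewrite /approx big_ord0 subrr enorm0 expr0 mul1r.
      move: (Dbound R M) (Dbound_ge0 R M) => D D0.
      by rewrite !mulr_ge0 ?enorm_ge0.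
  move=> s1 [cs1 [j7 j16 cn1 tm1] _ _ [hq hy]].
  case: (cs1) => d0 d1 d2 d6 [d9 d11].
  case: s1 cs1 d0 d1 d2 d6 d9 d11 j7 j16 cn1 tm1 hq hy.
  move=> ir1 ih1 fr1 fh1 tm1 nc1 /= cs1 d0 d1 d2 d6 d9 d11 j7 j16 cn1 ti1 hq hy.
  rewrite /tick /=; apply: runs_seq.
  apply: runs_iadd => b3 B3; rewrite d0 d9 addn0 in B3.
  apply: runs_nil.
  set a := 4 * eta * _ in hq; set T := Dbound R M * _ in hy.
  have T0 : 0 <= T := le_trans (enorm_ge0 _) hy.
  have hq' : enorm (read_vec n fh1 n - approx S x M N M) <= a + eta * T.
    by apply: le_trans hq _; rewrite lerDl mulr_ge0.
  apply: (@power_loop k M N tm1.+2 _ (approx S x M N M) a T _ N0 kE); rewrite /= ?/upd //=.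
  move=> s' cs' ts' es'; apply: HQ => //; apply: leq_trans ts' _.
  have nM : (n * M <= n * k)%N by rewrite leq_mul // kE leq_addr.
  move: nM ti1 kE; rewrite mulnDr (mulnCA M) (mulnC M n) -mulnA.
  by move: (n * M)%N (n * k)%N (M) (N); clear; lia.
- move=> i [ir ih fr fh tm nc] iM [/= [c0 c1 c2 c3] [c4 c5 c6 c7 [c9 c11]] [f2 f3 hE] [cn ti]].
  split.
    by rewrite c4 c5; move: iM ME kE rk k3 M0; move: (M) (N) ((k - 3) %% 4)%N; clear; lia.
  rewrite /tick /=.
  apply: runs_isub => b1 B1; rewrite c5 c3 in B1.
  apply: runs_iadd => b2 B2; rewrite /upd /= c6 c2 addn1 in B2.
  apply: runs_nil; split; rewrite /= /upd //=; split=> //.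
    by rewrite B1 mulnS addnC subnDA.
  by move: ti; clear; lia.
Qed.

End Run.

(** * Choice of the precision and conclusion *)

Lemma Bparam_ge (R : realType) n (A : 'M[R]_n) (eps : R) : (0 < n)%N ->
  0 < eps -> ln eps^-1 <= Bparam A eps.
Proof.
move=> n0 eps0; rewrite /Bparam ler_ln ?posrE ?invr_gt0 //; last first.
  by rewrite divr_gt0 // mulr_gt0 ?ltr0n // lt_max ltr01 orbT.
rewrite ler_pdivlMr // mulVf ?gt_eqF // -[leLHS]mulr1.
by apply: ler_pM => //; rewrite ?ler1n // le_max lexx orbT.
Qed.

Lemma ln2_ge (R : realType) : 1 / 2 <= ln 2 :> R.
Proof.
rewrite -ler_expR lnK ?posrE //.
rewrite -(@ler_pXn2r _ 2) ?nnegrE ?expR_ge0 //.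
rewrite -expRM_natl (_ : 2%:R * (1 / 2) = 1 :> R); last by field.
by have := expR1_le R; lra.
Qed.

(* The error amplification 6400 * 160^k is at most exp (13 + 8 k), which is
   absorbed by the precision. *)
Lemma precision_le (R : realType) (k : nat) (Ck Bm eps eta : R) :
  1000 <= Ck -> 1 <= Bm -> 0 < eps -> ln eps^-1 <= Bm -> k%:R <= Ck * Bm ->
  eta <= 2 `^ (- (2 * (14 + 8 * Ck) * Bm)) ->
  6400 * 160 ^+ k * eta <= eps.
Proof.
move=> hC hB eps0 heps hk he.
have e1 : 2 <= expR 1 :> R by have := expR_ge1Dx (1 : R); lra.
have h160 : 160 <= expR 8 :> R.
  rewrite -[8]mulr1 expRM_natl; apply: (@le_trans _ _ (2 ^+ 8)).
    by rewrite (_ : 2 ^+ 8 = 256); [lra | ring].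
  by apply: lerXn2r; rewrite ?nnegrE ?expR_ge0.
have h6400 : 6400 <= expR 13 :> R.
  rewrite -[13]mulr1 expRM_natl; apply: (@le_trans _ _ (2 ^+ 13)).
    have -> : 2 ^+ 13 = 2 * (64 * 64) :> R by ring.
    have -> : 6400 = 2 * (64 * 50) :> R by ring.
    by lra.
  by apply: lerXn2r; rewrite ?nnegrE ?expR_ge0.
have hx : 160 ^+ k <= expR (8 * k%:R) :> R.
  rewrite mulrC expRM_natl; apply: lerXn2r; rewrite ?nnegrE.
  - exact: ler0n.
  - exact: expR_ge0.
  - exact: h160.
have eE : eps = expR (- ln eps^-1) by rewrite lnV ?posrE // opprK lnK.
have heta : eta <= expR (- ((14 + 8 * Ck) * Bm)).
  apply: le_trans he _; rewrite /powR pnatr_eq0 /= ler_expR.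
  have l2 := ln2_ge R.
  have q0 : 0 <= (14 + 8 * Ck) * Bm.
    by apply: mulr_ge0; [move: hC | move: hB]; clear; lra.
  by rewrite mulNr lerN2 -mulrA mulrAC; move: l2 q0; clear; nra.
apply: (@le_trans _ _ (expR 13 * expR (8 * k%:R) * expR (- ((14 + 8 * Ck) * Bm)))).
  apply: (@le_trans _ _ (6400 * 160 ^+ k * expR (- ((14 + 8 * Ck) * Bm)))).
    apply: ler_wpM2l heta; apply: mulr_ge0; first exact: ler0n.
    exact: exprn_ge0 (ler0n _ 160).
  apply: ler_wpM2r; first exact: expR_ge0.
  by apply: ler_pM h6400 hx; [exact: ler0n | exact: exprn_ge0 (ler0n _ 160)].
rewrite -!expRD eE ler_expR; nra.
Qed.

(** 160 = 20 * 4 * 2: growth of the coefficients, of the differences and of the second loop. *)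
Lemma total_error_le (R : realType) (k M N : nat) (eta X : R) :
  0 <= eta -> 0 <= X -> k = (M + N)%N ->
  4 * eta * (Dbound R M * (4 ^+ M * X)) +
  eta * (2 ^+ N * (Dbound R M * (4 * (4 ^+ M * X)))) <=
  6400 * 160 ^+ k * eta / 2 * X.
Proof.
move=> eta0 X0 kE; rewrite /Dbound.
have -> : 4 * eta * (400 * 20 ^+ M * (4 ^+ M * X)) +
  eta * (2 ^+ N * (400 * 20 ^+ M * (4 * (4 ^+ M * X)))) =
  1600 * (20 ^+ M * 4 ^+ M) * (1 + 2 ^+ N) * (eta * X) by ring.
rewrite -exprMn (_ : 20 * 4 = 80); last by ring.
have -> : 6400 * 160 ^+ k * eta / 2 * X = 1600 * (80 ^+ k * (2 ^+ k * 2)) * (eta * X).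
  by rewrite (_ : 160 = 80 * 2) ?exprMn; [field | ring].
apply: ler_wpM2r; first by rewrite mulr_ge0.
rewrite -mulrA; apply: ler_wpM2l; first exact: ler0n.
have h2 : 1 <= 2 ^+ N :> R by rewrite exprn_ege1 // ler1n.
apply: ler_pM.
- exact: exprn_ge0 (ler0n _ 80).
- by apply: addr_ge0 => //; apply: le_trans h2.
- by rewrite ler_weXn2l // ?ler1n // kE leq_addr.
have : 2 ^+ N <= 2 ^+ k :> R by rewrite ler_weXn2l // ?ler1n // kE leq_addl.
by move: h2; lra.
Qed.

(** [S] has its eigenvalues t in (0, 1], so it and 1 - S are contractions, and the functional
    calculus reduces the approximation to [scalar_approx]. *)
Lemma spectral_approx (R : realType) n (A : 'M[R]_n) (x : 'cV[R]_n) (eps : R)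
    (M N : nat) (S := invmx (1%:M + (N + M)%:R^-1 *: A)) :
  psd A -> (0 < M)%N -> (3 * M <= N.+1)%N -> (N <= 3 * M + 2)%N -> 0 < eps ->
  1000 * Num.max (ln eps^-1) 1 <= (N + M)%:R ->
  [/\ forall v, enorm (S *m v) <= enorm v,
      forall v, enorm ((1%:M - S) *m v) <= enorm v &
      enorm (expmx (- A) *m x - S ^+ N *m approx S x M N M) <=
        eps / 2 * enorm x].
Proof.
move=> psdA M0 hN1 hN2 eps0 hk.
have [V [d [VV AE d0]]] := psd_spectral psdA.
pose kinv : R := (N + M)%:R^-1.
have kinv0 : 0 <= kinv by rewrite invr_ge0.
pose t i := (1 + kinv * d i)^-1.
have td i : 1 <= 1 + kinv * d i by rewrite lerDl mulr_ge0.
have t0 i : 0 <= t i by rewrite invr_ge0 (le_trans ler01).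
have t1 i : t i <= 1 by rewrite invf_le1 // (lt_le_trans ltr01).
have SE : S = spec V t.
  have E : 1%:M + kinv *: A = spec V (fun i => 1 + kinv * d i).
    by rewrite specD specZ spec1 // AE.
  (* An explicit inverse shows invertibility, so that [invmx] is not its default value. *)
  have TE : spec V (fun i => 1 + kinv * d i) *m spec V t = 1%:M.
    rewrite -specM // -(spec1 VV); congr spec; apply/funext => i.
    by rewrite divff // gt_eqF // (lt_le_trans ltr01).
  rewrite /S -/kinv E -[LHS]mulmx1 -TE mulKmx //.
  by have [] := mulmx1_unit TE.
have ZE : 1%:M - S = spec V (fun i => 1 - t i) by rewrite specB spec1 // SE.
split.
- move=> v; rewrite SE -[leRHS]mul1r; apply: enorm_spec => // i.
  by rewrite ger0_norm.
- move=> v; rewrite ZE -[leRHS]mul1r; apply: enorm_spec => // i.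
  by rewrite ger0_norm ?subr_ge0 // gerBl.
have -> : S ^+ N *m approx S x M N M = spec V (fun i => t i ^+ N *
    \sum_(j < M) lag R M N j * (1 - t i) ^+ j) *m x.
  rewrite specM // specX // -SE -mulmxA; congr (_ *m _).
  rewrite spec_sum mulmx_suml; apply: eq_bigr => j _.
  by rewrite specZ specX // -ZE scalemxAl.
have -> : expmx (- A) = spec V (fun i => expR (- d i)).
  rewrite -expmx_spec //; congr expmx.
  rewrite AE -scaleN1r -specZ; congr spec.
  by apply/funext => i; rewrite mulN1r.
rewrite -mulmxBl -specB; apply: enorm_spec => // [|i]; first by rewrite divr_ge0 // ltW.
exact: scalar_approx.
Qed.

Theorem theorem16 (R : realType) :
  exists (P : prog) (ck : R), 0 < ck /\
  forall Ck : R, ck <= Ck ->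
  exists c1 cb C : R, [/\ 0 < c1, 0 < cb, 0 < C &
  forall (n : nat) (A : 'M[R]_n) (x : 'cV[R]_n) (eps : R),
    (0 < n)%N -> psd A -> 0 < eps < 1 ->
  forall (k : nat) (eps1 : R) (b : nat),
    let L := Num.max (ln eps^-1) 1 in
    let B := Bparam A eps in
    ck * L <= k%:R <= Ck * L ->
    0 < eps1 <= 2 `^ (- (c1 * Num.max B 1)) ->
    cb * Num.max B 1 <= b%:R ->
  forall (solver : nat -> 'cV[R]_n -> 'cV[R]_n) (delta : nat -> R),
    (forall (j : nat) (w : 'cV[R]_n),
       enorm (invmx (1%:M + k%:R^-1 *: A) *m w - solver j w)
         <= eps1 * enorm w) ->
    (forall t : nat, `|delta t| <= 2 ^- b) ->
  exists s : state R,
    [/\ exec solver delta P (init k eps eps1 x) s,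
        ncalls s = k,
        (time s)%:R <= C * (n%:R * k%:R + k%:R * B ^+ 2) &
        enorm (expmx (- A) *m x - output n s) <= eps * enorm x]].
Proof.
exists exp_prog, 1000; split; first by rewrite ltr0n.
move=> Ck hC.
(* With k <= Ck Bm, the exponent 13 + 8 k + ln (1/eps) is at most (14 + 8 Ck) Bm; the factor 2
   converts powers of e into powers of 2, as ln 2 >= 1/2. *)
pose c : R := 2 * (14 + 8 * Ck).
have c0 : 0 < c by rewrite /c; move: hC; clear; lra.
(* 49 = 12 + 24 + 13, the coefficients of the running time, each of whose terms is at most its
   coefficient times n k. *)
exists c, c, 49; split; [exact: c0 | exact: c0 | by rewrite ltr0n |].
move=> n A x eps n0 psdA /andP[eps0 eps1'] k eps1 b L B.
move=> /andP[hk1 hk2] /andP[_ he] hb solver delta hs hd.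
have L1 : 1 <= L by rewrite /L le_max lexx orbT.
set Bm := Num.max B 1 in he hb.
have Bm1 : 1 <= Bm by rewrite /Bm le_max lexx orbT.
have lB : ln eps^-1 <= Bm by rewrite /Bm le_max Bparam_ge.
have LB : L <= Bm by rewrite /L ge_max lB Bm1.
have hkB : k%:R <= Ck * Bm.
  by apply: le_trans hk2 _; apply: ler_wpM2l LB; move: hC; clear; lra.
have k1000 : (1000 <= k)%N.
  rewrite -(ler_nat R); apply: le_trans hk1; rewrite -[leLHS]mulr1.
  by apply: ler_wpM2l L1; exact: ler0n.
have k3 : (3 <= k)%N by apply: leq_trans k1000.
(* One parameter dominates both the solver tolerance and the unit roundoff. *)
pose eta := Num.max eps1 (2 ^- b).
have u0 : 0 <= 2 ^- b :> R by rewrite invr_ge0 exprn_ge0.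
have eta0 : 0 <= eta by rewrite le_max u0 orbT.
have etaB : eta <= 2 `^ (- (2 * (14 + 8 * Ck) * Bm)).
  rewrite ge_max he /= -powR_mulrn // -powRN ler_powR ?ler1n //.
  by rewrite lerN2.
have hprec := precision_le hC Bm1 eps0 lB hkB etaB.
(* The final precision bound already contains this smallness, because eps < 1 <= 160^k. *)
have eta_le : 191 * eta <= 1.
  have h160 : 1 <= 160 ^+ k :> R by rewrite exprn_ege1 // ler1n.
  have : eta * 1 <= eta * 160 ^+ k by rewrite ler_wpM2l.
  by move: hprec eps1' eta0; rewrite -mulrA (mulrC _ eta); clear; lra.
pose M := ((k - 3) %/ 4).+1; pose N := (k - M)%N.
have [hN1 hN2 kE] : [/\ (3 * M <= N.+1)%N, (N <= 3 * M + 2)%N & k = (M + N)%N].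
  have := divn_eq (k - 3) 4; have : ((k - 3) %% 4 < 4)%N by rewrite ltn_mod.
  rewrite /N /M; move: k3; move: ((k - 3) %/ 4)%N ((k - 3) %% 4)%N; clear.
  by move=> p r h1 h2 h3; split; lia.
have kE' : (N + M)%N = k by rewrite addnC.
have := @spectral_approx R n A x eps M N psdA isT hN1 hN2 eps0.
rewrite kE' => /(_ hk1) [S_le subS_le hexp].
have delta_le t : `|delta t| <= eta by rewrite le_max hd orbT.
have solver_le j w :
    enorm (invmx (1%:M + k%:R^-1 *: A) *m w - solver j w) <= eta * enorm w.
  by apply: le_trans (hs j w) _; rewrite ler_wpM2r ?enorm_ge0 // le_max lexx.
have [s es [cs ts ers]] : runs solver delta exp_prog (init k eps eps1 x) (fun s =>
  [/\ ncalls s = k, (time s)%:R <= 49 * (n%:R * k%:R + k%:R * B ^+ 2) :> R &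
      enorm (expmx (- A) *m x - output n s) <= eps * enorm x]).
  have run := @runs_exp_prog R n _ x solver delta eta eta0 eta_le delta_le
    S_le subS_le solver_le k M N eps eps1 _ k3 erefl erefl.
  apply: run => s cs ts es.
  split=> //.
    have h1 : (time s <= 49 * (n * k))%N.
      have nk : (k <= n * k)%N by rewrite leq_pmull.
      move: ts nk; rewrite -mulnA; move: (n * k)%N (time s) k1000; clear; lia.
    rewrite mulrDr; apply: (@le_trans _ _ (49 * (n%:R * k%:R))).
      by rewrite -!natrM ler_nat.
    by rewrite lerDl; apply: mulr_ge0; [|apply: mulr_ge0; [|exact: sqr_ge0]]; exact: ler0n.
  have h2 := total_error_le eta0 (enorm_ge0 x) kE.
  have h3 : 6400 * 160 ^+ k * eta / 2 * enorm x <= eps / 2 * enorm x.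
    apply: ler_wpM2r; first exact: enorm_ge0.
    by apply: ler_wpM2r hprec; rewrite invr_ge0.
  have := enorm_dist (expmx (- A) *m x)
    (invmx (1%:M + k%:R^-1 *: A) ^+ N *m
       approx (invmx (1%:M + k%:R^-1 *: A)) x M N M) (output n s).
  by move: hexp (le_trans es (le_trans h2 h3)); clear; lra.
by exists s.
Qed.
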